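(* Let $X$ be a second countable locally compact Hausdorff space, let $\alpha$ be a finite non-zero non-negative Borel measure on $X$ with total mass $\beta=\alpha X>0$, and let $\mathcal D_\alpha$ be the Dirichlet–Ferguson measure with intensity $\alpha$. Let $q\in\mathbb N_1$, $\mathbf n=(n_1,\dots,n_q)\in\mathbb N_0^q$ and let $f_1,\dots,f_q\colon X\to\mathbb R$ be bounded Borel functions. Then $$\int_{\mathscr P(X)}\prod_{j=1}^q(\eta f_j)^{n_j}\,d\mathcal D_\alpha(\eta)=\frac{|\mathbf n|!}{\langle\beta\rangle_{|\mathbf n|}}\,Z^{(q)}_{\mathbf n}\Big(\big(\alpha(f_1^{a_1}\cdots f_q^{a_q})\big)_{\mathbf a\le\mathbf n}\Big).$$
   Context: Notation: $\mathbb N_1=\{1,2,\dots\}$, $\mathbb N_0=\{0,1,\dots\}$, $\mathbb N^q_*=\mathbb N_0^q\setminus\{\mathbf 0\}$, $0^0=1$; $|\mathbf a|=\sum_ja_j$, $\mathbf n!=\prod_jn_j!$, $\binom{|\mathbf a|}{\mathbf a}=|\mathbf a|!/\mathbf a!$; $\mathbf a\le\mathbf n$ coordinatewise; $\langle\beta\rangle_n=\beta(\beta+1)\cdots(\beta+n-1)$. $\mathscr P(X)$ is the space of Borel probability measures on $X$ with the narrow topology; for a finite Borel measure $\eta$ and bounded Borel $f$, $\eta f=\int f\,d\eta$. Dirichlet–Ferguson measure: the unique Borel probability measure $\mathcal D_\alpha$ on $\mathscr P(X)$ with Fourier transform $$\int_{\mathscr P(X)}e^{\mathrm i\,\eta f}\,d\mathcal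 D_\alpha(\eta)=\sum_{n=0}^\infty\frac{\mathrm i^n}{\langle\beta\rangle_n}Z_n(\alpha f,\alpha f^2,\dots,\alpha f^n),\qquad f\in C_b(X),$$ where $Z_n(t_1,\dots,t_n)=\sum_{\boldsymbol\lambda\in\mathbb N_0^n:\sum_ii\lambda_i=n}\prod_{i=1}^n\frac{t_i^{\lambda_i}}{i^{\lambda_i}\lambda_i!}$ is the cycle index polynomial of the symmetric group. A $q$-chromatic partition $A\vDash\mathbf n$ is a finitely supported map $A\colon\mathbb N^q_*\to\mathbb N_0$ with $\sum_{\mathbf a}A(\mathbf a)\,\mathbf a=\mathbf n$. The $q$-chromatic cycle index polynomial is $Z^{(q)}_{\mathbf n}(\mathbf t)=\frac1{|\mathbf n|!}\sum_{A\vDash\mathbf n}M(A)\prod_{\mathbf a\in\mathrm{supp}A}t_{\mathbf a}^{A(\mathbf a)}$, $\mathbf t=(t_{\mathbf a})_{\mathbf a\le\mathbf n}$, with $Z^{(q)}_{\mathbf 0}=1$ and $M(A)=\mathbf n!\prod_{\mathbf a\in\mathrm{supp}A}\frac{\binom{|\mathbf a|}{\mathbf a}^{A(\mathbf a)}}{|\mathbf a|^{A(\mathbf a)}A(\mathbf a)!}$. *)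

(* Defs.v *)
From HB Require Import structures.
From mathcomp Require Import all_boot all_order all_algebra finmap.
From mathcomp Require Import complex.
From mathcomp Require Import all_classical all_reals all_analysis.

Set Implicit Arguments.
Unset Strict Implicit.
Unset Printing Implicit Defensive.

Import Order.TTheory GRing.Theory Num.Theory.
Import numFieldNormedType.Exports.

Local Open Scope classical_set_scope.
Local Open Scope ring_scope.

(* Measurable types are pointed, hence [ptopologicalType]; a space that carries
   a non-zero measure is inhabited anyway. *)
Definition borel (X : ptopologicalType) : measurableType (@open X).-sigma :=
  g_sigma_algebraType (@open X).

Definition Cb (X : topologicalType) (R : realType) : Type :=
  {f : X -> R | continuous f /\ bounded_fun f}.

(* Borel probability measures on X with the coarsest topology for which all
   eta |-> \int f d(eta), f in C_b(X), are continuous. *)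
Definition narrow (X : ptopologicalType) (R : realType) : ptopologicalType :=
  initial_topology
    (fun eta : probability (borel X) R =>
       (fun f : Cb X R => \int[eta]_x sval f x) : {ptws Cb X R -> R}).

(* Tuples (lambda_1, ..., lambda_n) with sum_k k lambda_k = n; lambda_k is
   [l i] with k = i.+1. *)
Definition cycle_type (n : nat) : set {ffun 'I_n -> nat} :=
  [set l | (\sum_(i < n) i.+1 * l i = n)%N].
Arguments cycle_type n : clear implicits.

Section DirichletFerguson.
Variable R : realType.

Definition rising (b : R) (n : nat) : R := \prod_(i < n) (b + i%:R).

(* [t k] stands for the variable t_k, of which only t_1, ..., t_n occur. *)
Definition cycle_index (n : nat) (t : nat -> R) : R :=
  \sum_(l \in cycle_type n)
    (\prod_(i < n) (t i.+1 ^+ l i / (i.+1%:R ^+ l i * (l i)`!%:R))).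

Local Open Scope complex_scope.

Definition expi (x : R) : R[i] := cos x +i* sin x.

Definition Cintegral d (T : measurableType d) (mu : {measure set T -> \bar R})
    (g : T -> R[i]) : R[i] :=
  (\int[mu]_x complex.Re (g x)) +i* (\int[mu]_x complex.Im (g x)).

(* The usual topology of the complex numbers is inferred for [R[i]] only when
   it is seen as a [numFieldType]. *)
Definition Cseries_cvg_to (u : nat -> R[i]) (l : R[i]) : Prop :=
  (series u : nat -> (R[i] : numFieldType)) @ \oo --> (l : (R[i] : numFieldType)).

Definition mass (X : ptopologicalType)
    (alpha : {finite_measure set (borel X) -> \bar R}) : R :=
  fine (alpha [set: borel X]).

(* The Fourier transform determines the Dirichlet-Ferguson measure uniquely. *)
Definition is_Dirichlet_Ferguson (X : ptopologicalType)
    (alpha : {finite_measure set (borel X) -> \bar R})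
    (D : probability (borel (narrow X R)) R) : Prop :=
  forall f : X -> R, continuous f -> bounded_fun f ->
    Cseries_cvg_to
      (fun n => 'i ^+ n / (rising (mass alpha) n)%:C
                * (cycle_index n (fun k => \int[alpha]_x (f x ^+ k)))%:C)
      (Cintegral D (fun eta : probability (borel X) R =>
                      expi (\int[eta]_x f x))).

End DirichletFerguson.

Section Chromatic.
Variables (R : realType) (q : nat).

Definition mindex_pos := {a : {ffun 'I_q -> nat} | a != [ffun=> 0%N]}.

Definition mdeg (a : {ffun 'I_q -> nat}) : nat := \sum_(j < q) a j.

Definition mfact (a : {ffun 'I_q -> nat}) : nat := \prod_(j < q) (a j)`!.

Definition multinomial (a : {ffun 'I_q -> nat}) : R :=
  (mdeg a)`!%:R / (mfact a)%:R.

Definition chromatic_partition (n : {ffun 'I_q -> nat}) :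
    set {fsfun mindex_pos -> nat with 0%N} :=
  [set A : {fsfun mindex_pos -> nat with 0%N} |
    forall j : 'I_q, (\sum_(a <- finsupp A) A a * val a j = n j)%N].

Definition chromatic_coef (n : {ffun 'I_q -> nat})
    (A : {fsfun mindex_pos -> nat with 0%N}) : R :=
  (mfact n)%:R *
  \prod_(a <- finsupp A)
    (multinomial (val a) ^+ A a / ((mdeg (val a))%:R ^+ A a * (A a)`!%:R)).

(* The variables form a total family [t]; only those t_a with a <= n and a <> 0
   occur. *)
Definition chromatic_cycle_index (n : {ffun 'I_q -> nat})
    (t : {ffun 'I_q -> nat} -> R) : R :=
  (mdeg n)`!%:R^-1 *
  \sum_(A \in chromatic_partition n)
    (chromatic_coef n A * \prod_(a <- finsupp A) t (val a) ^+ A a).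

End Chromatic.

(* Sums [\sum_(i \in S)] are 0 by convention over infinite supports; this does
   not affect the two sums above. *)
Lemma finite_set_inj_in (T U : Type) (A : set T) (F : T -> U) :
  {in A &, injective F} -> finite_set (F @` A) -> finite_set A.
Proof. by move=> /inj_card_eq/eq_finite_set ->. Qed.

Lemma cycle_type_finite (n : nat) : finite_set (cycle_type n).
Proof.
pose F (l : {ffun 'I_n -> nat}) : {ffun 'I_n -> 'I_n.+1} := [ffun i => inord (l i)].
apply: (@finite_set_inj_in _ _ _ F); last exact: finite_finset.
have le l i : cycle_type n l -> (l i < n.+1)%N.
  move=> ln; rewrite ltnS -[leqRHS]ln (bigD1 i)//=.
  by rewrite (leq_trans _ (leq_addr _ _))// leq_pmull.
move=> l m; rewrite !inE => ln mn /ffunP lm; apply/ffunP => i.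
by have := lm i; rewrite !ffunE => /(congr1 val) /=; rewrite !inordK ?le.
Qed.

Lemma chromatic_partition_finite (q : nat) (n : {ffun 'I_q -> nat}) :
  finite_set (chromatic_partition n).
Proof.
pose N := mdeg n.
pose W (A : {fsfun mindex_pos q -> nat with 0%N}) (b : {ffun 'I_q -> 'I_N.+1}) :=
  if insub [ffun j => val (b j)] is Some a then A a else 0%N.
pose F A : {ffun {ffun 'I_q -> 'I_N.+1} -> 'I_N.+1} := [ffun b => inord (W A b)].
apply: (@finite_set_inj_in _ _ _ F); last exact: finite_finset.
have le0 A (a : mindex_pos q) j : chromatic_partition n A ->
    (A a * val a j <= N)%N.
  move=> An; rewrite (@leq_trans (n j))//; last first.
    by rewrite /N /mdeg (bigD1 j)//= leq_addr.
  rewrite -(An j); have [aA|/fsfun_dflt ->//] := boolP (a \in finsupp A).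
  by rewrite (big_fsetD1 a)//= leq_addr.
have pos (a : mindex_pos q) : exists j, (0 < val a j)%N.
  apply/existsP; apply: contraT; rewrite negb_exists => /forallP a0.
  have /negP[] := valP a; apply/eqP/ffunP => j; rewrite ffunE.
  by apply/eqP; rewrite -leqn0 leqNgt.
have leA A (a : mindex_pos q) : chromatic_partition n A -> (A a <= N)%N.
  move=> An; have [j aj] := pos a.
  by rewrite (leq_trans _ (le0 A a j An))// leq_pmulr.
have leW A b : chromatic_partition n A -> (W A b < N.+1)%N.
  by move=> An; rewrite /W ltnS; case: insub => // a; exact: leA.
have key A B a : chromatic_partition n A -> chromatic_partition n B ->
    F A = F B -> A a != 0%N -> A a = B a.
  move=> An Bn /ffunP AB Aa0.
  have aN j : (val a j < N.+1)%N.
    by rewrite ltnS (leq_trans _ (le0 A a j An))// leq_pmull// lt0n.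
  have Wa C : W C [ffun j => inord (val a j)] = C a.
    rewrite /W; have -> : [ffun j => val ([ffun j => inord (val a j)] j : 'I_N.+1)]
        = val a by apply/ffunP => j; rewrite !ffunE /= inordK.
    by rewrite valK.
  rewrite -!Wa; have := AB [ffun j => inord (val a j)].
  by rewrite !ffunE => /(congr1 val) /=; rewrite !inordK ?leW.
move=> A B; rewrite !inE => An Bn AB; apply/fsfunP => a.
have [A0|A0] := eqVneq (A a) 0%N; last exact: key.
have [B0|B0] := eqVneq (B a) 0%N; first by rewrite A0 B0.
by rewrite (key B A).
Qed.

(* Main.v *)
Require Import Defs.
From HB Require Import structures.
From mathcomp Require Import all_boot all_order all_algebra finmap.
From mathcomp Require Import complex.
From mathcomp Require Import all_classical all_reals all_analysis.
From mathcomp Require Import measurable_realfun giry ring lra.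

Set Implicit Arguments.
Unset Strict Implicit.
Unset Printing Implicit Defensive.

Import Order.TTheory GRing.Theory Num.Theory.
Import numFieldNormedType.Exports.

Local Open Scope classical_set_scope.
Local Open Scope ring_scope.

(** The Fourier transform of the Dirichlet-Ferguson measure D, taken at s f, is
a power series in the real number s.  For a bounded continuous f the integral of
exp (i s eta f) is also the sum of the series of the i^n s^n / n! times the
n-th moment of eta f, so equating coefficients gives

     \int (eta f)^n dD = n! / <beta>_n Z_n (alpha f, ..., alpha f^n)

([moment_continuous]).  Both sides depend continuously on f for uniformly
bounded convergence in L^1(alpha + M), where M is the mean of D, that is
M h = \int (eta h) dD; the bounded continuous functions are dense for this
convergence, on a locally compact Hausdorff space with a countable basis
([bounded_continuous_dense]), so the formula holds for all bounded Borel f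
([moment_bounded_measurable]).

The joint moments follow by polarization.  For f = \sum_j c_j f_j both sides
are polynomials in the coefficients c_j.  On the left, the multinomial theorem
shows that the coefficient of c^n is the multinomial coefficient of n times the
joint moment ([Rintegral_power_of_sum]).  On the right it is the same
multinomial coefficient times N! / <beta>_N times the chromatic cycle index,
where N = |n| ([cycle_index_chromatic]): the cycle index Z_N is the coefficient
of z^N in exp (\sum_i t_i z^i / i), and replacing each t_i = alpha (f^i) by its
multinomial expansion turns this exponential into the product over nonzero
multi-indices a of the exponentials of
binom(|a|, a) / |a| * c^a * alpha (f^a) * z^|a|, whose expansion is a sum over
chromatic partitions.  As the c_j range over all reals, the coefficients agree
([monomials_free]). *)

(** * Truncated exponentials and cycle indices *)

Lemma big_triangle (V : nmodType) (G : nat -> nat -> V) (N : nat) :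
  \sum_(l < N) \sum_(i < l.+1) G (l - i)%N i =
  \sum_(i < N) \sum_(j < N | (i + j < N)%N) G j i.
Proof.
transitivity (\sum_(l < N) \sum_(i < N | (i <= l)%N) G (l - i)%N i).
  by apply: eq_bigr => l _; rewrite (big_ord_widen N (fun i => G (l - i)%N i)).
rewrite (exchange_big_dep xpredT)//=; apply: eq_bigr => i _.
rewrite -(big_mkord (fun l => i <= l)%N (fun l => G (l - i)%N i)).
rewrite -(big_mkord (fun j => i + j < N)%N (fun j => G j i)).
have -> : \sum_(0 <= l < N | (i <= l)%N) G (l - i)%N i =
    \sum_(i <= l < N) G (l - i)%N i.
  rewrite (big_cat_nat (n := i))//=; last exact: ltnW.
  rewrite big_nat_cond big_pred0 ?add0r; last first.
    by move=> l /=; case: (leqP i l); rewrite ?andbF.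
  by rewrite big_nat_cond [RHS]big_nat_cond; apply: eq_bigl => l;
    case: (leqP i l); rewrite ?andbF ?andbT.
rewrite -{1}(add0n (i : nat)) big_addn.
rewrite (big_nat_widen _ _ N) ?leq_subr//.
apply: eq_big => [j|j _]; first by rewrite ltn_subRL.
by rewrite addnK.
Qed.

Section exp_trunc.
Context {F : numFieldType}.
Implicit Types p q : {poly F}.

(** Only coefficients of degree at most N ever matter, so truncated
exponentials modulo X^(N+1) stand in for exponentials of formal power series.
*)
Definition exp_trunc (N : nat) p : {poly F} :=
  \sum_(l < N.+1) l`!%:R^-1 *: p ^+ l.

Lemma exp_trunc0 N : exp_trunc N 0 = 1.
Proof.
rewrite /exp_trunc big_ord_recl fact0 invr1 scale1r expr0 big1 ?addr0// => i _.
by rewrite exprS mul0r scaler0.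
Qed.

(** The two sides differ by the terms p^j q^i / (j! i!) with i, j <= N < i +
j, each of which is divisible by X^(i + j). *)
Lemma exp_truncD N p q : 'X %| p -> 'X %| q ->
  'X^(N.+1) %| exp_trunc N (p + q) - exp_trunc N p * exp_trunc N q.
Proof.
move=> Xp Xq.
pose G j i := (j`!%:R^-1 *: p ^+ j) * (i`!%:R^-1 *: q ^+ i).
have -> : exp_trunc N (p + q) =
    \sum_(i < N.+1) \sum_(j < N.+1 | (i + j < N.+1)%N) G j i.
  rewrite -(big_triangle G); apply: eq_bigr => l _.
  rewrite exprDn scaler_sumr; apply: eq_bigr => i _.
  rewrite /G -scalerAl -scalerAr scalerA -[_ *+ 'C(_, _)]scaler_nat scalerA.
  congr (_ *: _).
  have il : (i <= l)%N by rewrite -ltnS.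
  have C0 : ('C(l, i))%:R != 0 :> F by rewrite pnatr_eq0 -lt0n bin_gt0.
  by rewrite -(bin_fact il) !natrM invfM mulrAC mulVf// mul1r invfM mulrC.
have -> : exp_trunc N p * exp_trunc N q =
    \sum_(i < N.+1) \sum_(j < N.+1) G j i.
  by rewrite mulrC /exp_trunc big_distrl/=; apply: eq_bigr => i _;
    rewrite big_distrr/=; apply: eq_bigr => j _; rewrite mulrC.
rewrite -sumrB; apply: (big_ind (fun r => 'X^(N.+1) %| r)) => [|r s|i _].
- exact: dvdp0.
- exact: dvdp_add.
rewrite [X in _ - X](bigID (fun j : 'I_N.+1 => (i + j < N.+1)%N))/=.
rewrite opprD addrA subrr add0r -mulN1r; apply: dvdp_mull.
apply: (big_ind (fun r => 'X^(N.+1) %| r)) => [|r s|j].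
- exact: dvdp0.
- exact: dvdp_add.
rewrite -leqNgt => ij; rewrite /G -scalerAl -scalerAr.
rewrite !dvdpZr ?invr_eq0 ?pnatr_eq0 -?lt0n ?fact_gt0//.
apply: (@dvdp_trans _ 'X^(i + j)); first by rewrite dvdp_Pexp2l ?size_polyX.
by rewrite addnC exprD dvdp_mul// dvdp_exp2r.
Qed.

Lemma exp_trunc_sum N (I : finType) (P : pred I) (p : I -> {poly F}) :
  (forall i, P i -> 'X %| p i) ->
  'X^(N.+1) %|
    exp_trunc N (\sum_(i | P i) p i) - \prod_(i | P i) exp_trunc N (p i).
Proof.
move=> Xp; suff : ('X %| \sum_(i | P i) p i) /\ ('X^(N.+1) %|
    exp_trunc N (\sum_(i | P i) p i) - \prod_(i | P i) exp_trunc N (p i)).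
  by case.
apply: (big_rec2 (fun s t => ('X %| s) /\ ('X^(N.+1) %| exp_trunc N s - t))).
  by rewrite exp_trunc0 subrr !dvdp0.
move=> i s t Pi [Xs st]; split; first by rewrite dvdp_add// Xp.
rewrite (_ : _ - _ =
    (exp_trunc N (p i + s) - exp_trunc N (p i) * exp_trunc N s) +
    exp_trunc N (p i) * (exp_trunc N s - t)); last first.
  by rewrite mulrBr addrA subrK.
by rewrite dvdp_add// ?exp_truncD ?Xp// dvdp_mull.
Qed.

Lemma coef_eq_mod N p q k : 'X^(N.+1) %| p - q -> (k <= N)%N -> p`_k = q`_k.
Proof.
move=> /dvdpP[r rE] kN; apply/eqP; rewrite -subr_eq0 -coefB rE coefMXn ltnS kN.
by [].
Qed.

(** The factor p - q divides each p^l - q^l. *)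
Lemma exp_trunc_eq_mod N p q : 'X^(N.+1) %| p - q ->
  'X^(N.+1) %| exp_trunc N p - exp_trunc N q.
Proof.
move=> pq; rewrite -sumrB.
apply: (big_ind (fun r => 'X^(N.+1) %| r)) => [|r s|l _].
- exact: dvdp0.
- exact: dvdp_add.
by rewrite -scalerBr -mul_polyC dvdp_mull// subrXX dvdp_mulr.
Qed.

Lemma dvdX_scaleXn (c : F) d : (0 < d)%N -> 'X %| c *: 'X^d.
Proof.
by case: d => // d _; rewrite -mul_polyC dvdp_mull// exprS dvdp_mulr.
Qed.

(** Expanding the product picks a power [A i] in the i-th factor: this is how
partitions enter, [A i] being the multiplicity of the part [d i]. *)
Lemma coef_prod_exp_trunc N (I : finType) (d : I -> nat) (u : I -> F) k :
  (\prod_i exp_trunc N (u i *: 'X^(d i)))`_k =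
  \sum_(A : {ffun I -> 'I_N.+1} | (\sum_i A i * d i)%N == k)
    \prod_i (u i ^+ A i / (A i)`!%:R).
Proof.
rewrite bigA_distr_bigA/= coef_sum [RHS]big_mkcond/=; apply: eq_bigr => A _.
have -> : \prod_i ((A i)`!%:R^-1 *: (u i *: 'X^(d i)) ^+ A i) =
    (\prod_i (u i ^+ A i / (A i)`!%:R)) *: 'X^(\sum_i A i * d i).
  transitivity (\prod_i ((u i ^+ A i / (A i)`!%:R)%:P * 'X^(A i * d i))).
    apply: eq_bigr => i _; rewrite exprZn scalerA mul_polyC -exprM mulnC.
    by rewrite [X in X *: _]mulrC.
  by rewrite big_split/= -rmorph_prod/= mul_polyC -expr_sum.
by rewrite coefZ coefXn eq_sym; case: eqP; rewrite ?mulr1// mulr0.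
Qed.

Lemma coef_exp_truncX N (c : F) k : (k <= N)%N ->
  (exp_trunc N (c *: 'X))`_k = c ^+ k / k`!%:R.
Proof.
move=> kN; rewrite coef_sum (bigD1 (Ordinal (kN : (k < N.+1)%N)))//=.
rewrite exprZn !coefZ coefXn eqxx mulr1 mulrC big1 ?addr0// => i ik.
rewrite exprZn !coefZ coefXn; case: eqP => [ki|_]; last by rewrite !mulr0.
by move: ik; rewrite -val_eqE/= ki eqxx.
Qed.

End exp_trunc.

Section box.
Variables (q N : nat).
(** The multi-indices of total degree at most N have all entries at most N;
keeping them in a finite type gives access to finite sums and products. *)
Definition box := {ffun 'I_q -> 'I_N.+1}.
Definition bval (b : box) : {ffun 'I_q -> nat} := [ffun j => b j : nat].

Lemma mdeg_bval b : mdeg (bval b) = (\sum_(j < q) b j)%N.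
Proof. by apply: eq_bigr => j _; rewrite ffunE. Qed.

End box.

(** Coefficient of X^k in the identity between the exponential of (\sum_j x_j)
X and the product of the exponentials of the x_j X. *)
Lemma multinomial_theorem (R : realType) (q N : nat) (x : 'I_q -> R) k :
  (k <= N)%N ->
  (\sum_j x j) ^+ k =
  \sum_(b : box q N | mdeg (bval b) == k)
     multinomial R (bval b) * \prod_j x j ^+ b j.
Proof.
move=> kN; have := coef_exp_truncX (\sum_j x j) kN.
rewrite scaler_suml (coef_eq_mod (exp_trunc_sum N _) kN); last first.
  by move=> i _; rewrite -mul_polyC dvdp_mull.
rewrite (coef_prod_exp_trunc N (fun=> 1%N)) => /(congr1 ( *%R^~ k`!%:R)).
rewrite /= divfK ?pnatr_eq0 -?lt0n ?fact_gt0// => <-.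
rewrite big_distrl/=; apply: eq_big => b.
  by rewrite mdeg_bval; congr (_ == _); apply: eq_bigr => j _; rewrite muln1.
rewrite /multinomial mdeg_bval => /eqP.
under eq_bigr do rewrite muln1.
move=> ->; rewrite mulrC -mulrA; congr (_ * _).
rewrite big_split/= mulrC; congr (_ * _).
rewrite /mfact natr_prod -prodfV; apply: eq_bigr => j _.
by rewrite ffunE.
Qed.

Lemma fsbig_finType (V : nmodType) (I : finType) (P : pred I) (F : I -> V) :
  \sum_(i \in [set i | P i]) F i = \sum_(i | P i) F i.
Proof.
rewrite -big_enum/= [RHS]fsbig_seq ?enum_uniq//.
congr (\sum_(i \in _) _).
by apply/seteqP; split => i /=; rewrite mem_enum.
Qed.

(** The generating function of the cycle indices is exp (\sum_i t_i z^i / i).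
*)
Lemma cycle_index_coef (R : realType) n (t : nat -> R) :
  cycle_index n t =
  (\prod_(i < n) exp_trunc n ((t i.+1 / i.+1%:R) *: 'X^(i.+1)))`_n.
Proof.
rewrite (coef_prod_exp_trunc n (fun i : 'I_n => i.+1)
  (fun i : 'I_n => t i.+1 / i.+1%:R)) -fsbig_finType.
pose h (A : {ffun 'I_n -> 'I_n.+1}) : {ffun 'I_n -> nat} :=
  [ffun i => A i : nat].
rewrite /cycle_index (reindex_fsbig h
  [set A : {ffun 'I_n -> 'I_n.+1} | (\sum_i A i * i.+1)%N == n])/=; last first.
  split.
  - move=> A /= /eqP An; rewrite /cycle_type/= -[RHS]An.
    by apply: eq_bigr => i _; rewrite ffunE mulnC.
  - move=> A B _ _ /ffunP AB; apply/ffunP => i; apply: val_inj.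
    by have := AB i; rewrite !ffunE.
  - move=> l /= ln; have ub i : (l i < n.+1)%N.
      rewrite ltnS -[leqRHS]ln (bigD1 i)//=.
      by rewrite (leq_trans _ (leq_addr _ _))// leq_pmull.
    exists [ffun i => Ordinal (ub i)] => /=.
      by rewrite -[eqbRHS]ln; apply/eqP/eq_bigr => i _; rewrite ffunE mulnC.
    by apply/ffunP => i; rewrite !ffunE.
apply: eq_fsbigr => A _; apply: eq_bigr => i _.
by rewrite ffunE expr_div_n invfM mulrA.
Qed.

Section chromatic.
Context {R : realType} (q N : nat).
Local Notation B := (box q N).

(** The parts that a chromatic partition of total degree N may use. *)
Definition pbox : finType := {b : B | b != [ffun=> ord0]}.

Lemma bval_pbox_neq0 (b : pbox) : bval (val b) != [ffun=> 0%N].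
Proof.
apply: contra (valP b) => /eqP/ffunP b0; apply/eqP/ffunP => j.
by apply/val_inj; have := b0 j; rewrite !ffunE.
Qed.

Definition pbox_mindex (b : pbox) : mindex_pos q :=
  exist _ (bval (val b)) (bval_pbox_neq0 b).

Lemma pbox_mindex_inj : injective pbox_mindex.
Proof.
move=> b b' /(congr1 val)/= /ffunP bb'; apply/val_inj/ffunP => j.
by apply/val_inj; have := bb' j; rewrite !ffunE.
Qed.

Definition mindex_pbox (a : mindex_pos q) : option pbox :=
  [pick b | pbox_mindex b == a].

Lemma pbox_mindexK : pcancel pbox_mindex mindex_pbox.
Proof.
move=> b; rewrite /mindex_pbox; case: pickP => [b' /eqP/pbox_mindex_inj -> //|].
by move=> /(_ b); rewrite eqxx.
Qed.

Lemma mindex_le_pbox (a : mindex_pos q) : (forall j, (val a j <= N)%N) ->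
  exists b, pbox_mindex b = a.
Proof.
move=> aN; pose b : B := [ffun j => inord (val a j)].
have bE : bval b = val a.
  by apply/ffunP => j; rewrite !ffunE inordK ?ltnS; last exact: aN.
have b0 : b != [ffun=> ord0].
  apply: contra (valP a) => /eqP b0; rewrite -bE b0; apply/eqP/ffunP => j.
  by rewrite !ffunE.
by exists (exist _ b b0 : pbox); apply: val_inj.
Qed.

Definition fsfun_of_pbox (A : {ffun pbox -> 'I_N.+1}) :
    {fsfun mindex_pos q -> nat with 0%N} :=
  [fsfun a in [fset pbox_mindex b | b in pbox]%fset =>
     if mindex_pbox a is Some b then A b : nat else 0%N].

Lemma fsfun_of_pboxE A b : fsfun_of_pbox A (pbox_mindex b) = A b.
Proof.
rewrite fsfunE pbox_mindexK; case: ifPn => // /imfsetP[].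
by exists b.
Qed.

(** Indices outside the support contribute the neutral element, so an
operation over the varying finite support becomes one over a fixed finite
type. *)
Lemma big_finsupp_pbox (V : Type) (idx : V) (op : Monoid.com_law idx)
    (A : {fsfun mindex_pos q -> nat with 0%N}) (F : mindex_pos q -> V) :
  {in finsupp A, forall a, exists b, pbox_mindex b = a} ->
  (forall a, A a = 0%N -> F a = idx) ->
  \big[op/idx]_(a <- finsupp A) F a = \big[op/idx]_(b : pbox) F (pbox_mindex b).
Proof.
move=> suppA F0.
rewrite -big_enum/= -(big_map pbox_mindex xpredT F).
rewrite [RHS](bigID [pred a | a \in finsupp A])/=.
rewrite [X in op _ X]big1 ?Monoid.mulm1.
  rewrite -[RHS]big_filter; apply: perm_big; apply: uniq_perm => //.
  - exact: fset_uniq.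
  - by rewrite filter_uniq// (map_inj_uniq pbox_mindex_inj) enum_uniq.
  move=> a; rewrite mem_filter/=; case: (boolP (a \in finsupp A)) => //= aA.
  by have [b <-] := suppA _ aA; rewrite map_f// mem_enum.
by move=> a aA; apply: F0; apply/fsfun_dflt.
Qed.

Lemma fsfun_of_pbox_supp (A : {ffun pbox -> 'I_N.+1}) :
  {in finsupp (fsfun_of_pbox A), forall a, exists b, pbox_mindex b = a}.
Proof.
move=> a; rewrite mem_finsupp fsfunE; case: ifPn; last by rewrite eqxx.
by move=> /imfsetP[b _ ->] _; exists b.
Qed.

(** In a chromatic partition of n, each part a with multiplicity m > 0
satisfies m * a_j <= n_j <= N, and a has a positive entry: parts and
multiplicities are bounded by N, and the sum runs over a finite function type.
*)
Lemma chromatic_cycle_index_pbox (n : {ffun 'I_q -> nat})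
    (t : {ffun 'I_q -> nat} -> R) : mdeg n = N ->
  chromatic_cycle_index n t = (mfact n)%:R / N`!%:R *
  \sum_(A : {ffun pbox -> 'I_N.+1} |
      [forall j, (\sum_b A b * val b j == n j)%N])
    \prod_b ((multinomial R (bval (val b)) / (mdeg (bval (val b)))%:R
              * t (bval (val b))) ^+ A b / (A b)`!%:R).
Proof.
move=> nN; rewrite /chromatic_cycle_index nN mulrAC [in RHS]mulrC.
congr (_ * _); rewrite mulr_sumr -fsbig_finType.
rewrite (reindex_fsbig fsfun_of_pbox
  [set A : {ffun pbox -> 'I_N.+1} |
    [forall j, (\sum_b A b * val b j == n j)%N]])/=; last first.
  split.
  - move=> A /= /forallP An j.
    rewrite big_finsupp_pbox//; last 2 first.
    + exact: fsfun_of_pbox_supp.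
    + by move=> a ->.
    rewrite -(eqP (An j)); apply: eq_bigr => b _.
    by rewrite fsfun_of_pboxE/= ffunE.
  - move=> A A' _ _ /fsfunP AA'; apply/ffunP => b; apply: val_inj.
    by have := AA' (pbox_mindex b); rewrite !fsfun_of_pboxE.
  - move=> A /= An.
    have le0 a j : a \in finsupp A -> (A a * val a j <= N)%N.
      move=> aA; rewrite (@leq_trans (n j))//; last first.
        by rewrite -nN /mdeg (bigD1 j)//= leq_addr.
      by rewrite -(An j) (big_fsetD1 a)//= leq_addr.
    have supp : {in finsupp A, forall a, exists b, pbox_mindex b = a}.
      move=> a aA; apply: mindex_le_pbox => j; apply: leq_trans (le0 a j aA).
      by rewrite leq_pmull// lt0n -mem_finsupp.
    have leA a : (A a < N.+1)%N.
      have [aA|/fsfun_dflt ->//] := boolP (a \in finsupp A).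
      have /existsP[j aj] : [exists j, (0 < val a j)%N].
        apply: contraT; rewrite negb_exists => /forallP a0.
        have /negP[] := valP a; apply/eqP/ffunP => j; rewrite ffunE.
        by apply/eqP; rewrite -leqn0 leqNgt.
      by rewrite ltnS (leq_trans _ (le0 a j aA))// leq_pmulr.
    exists [ffun b => Ordinal (leA (pbox_mindex b))] => /=.
      apply/forallP => j; rewrite -(An j) big_finsupp_pbox//; last first.
        by move=> a ->.
      by apply/eqP/eq_bigr => b _; rewrite !ffunE/= ?ffunE.
    apply/fsfunP => a; have [aA|aA] := boolP (a \in finsupp A).
      by have [b <-] := supp _ aA; rewrite fsfun_of_pboxE ffunE.
    rewrite (fsfun_dflt aA); case: (mindex_pbox a) (pbox_mindexK) => *.
      rewrite fsfunE; case: ifPn => // /imfsetP[b _ ab]; move: aA; rewrite ab.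
      by rewrite pbox_mindexK ffunE/= => /fsfun_dflt.
    rewrite fsfunE; case: ifPn => // /imfsetP[b _ ab]; move: aA; rewrite ab.
    by rewrite pbox_mindexK ffunE/= => /fsfun_dflt.
apply: eq_fsbigr => A _; rewrite /chromatic_coef -mulrA; congr (_ * _).
rewrite -big_split/= big_finsupp_pbox; last 2 first.
- exact: fsfun_of_pbox_supp.
- by move=> a ->; rewrite !expr0 mul1r fact0 !mulr1 invr1.
apply: eq_bigr => b _; rewrite fsfun_of_pboxE/= !exprMn exprVn invfM.
by rewrite -!mulrA !exprVn [_^-1 * t _ ^+ _]mulrC.
Qed.

End chromatic.

Lemma mdeg_gt0 q (a : {ffun 'I_q -> nat}) : a != [ffun=> 0%N] -> (0 < mdeg a)%N.
Proof.
apply: contraR; rewrite -leqNgt leqn0 sum_nat_eq0 => /forallP a0.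
by apply/eqP/ffunP => j; rewrite ffunE; apply/eqP; exact: (a0 j).
Qed.

(** Both sides are coefficients of z^N. The exponent of the generating
function of Z_N, once each p_i is expanded, is the sum over nonzero
multi-indices a of w_a c^a z^|a| with w_a = binom(|a|, a) t_a / |a|. The
exponential of this sum is a product of exponentials; expanding it gives a sum
over multiplicity functions A, which are then grouped according to the
multi-index \sum_a A(a) a that they partition. *)
Lemma cycle_index_chromatic (R : realType) (q N : nat) (c : 'I_q -> R)
    (t : {ffun 'I_q -> nat} -> R) (p : nat -> R) :
  (forall k, (k <= N)%N -> p k = \sum_(a : box q N | mdeg (bval a) == k)
      multinomial R (bval a) * \prod_j c j ^+ a j * t (bval a)) ->
  cycle_index N p = \sum_(m : box q N | mdeg (bval m) == N)
    (\prod_j c j ^+ m j) * (multinomial R (bval m)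
    * chromatic_cycle_index (bval m) t).
Proof.
move=> pE; rewrite cycle_index_coef.
pose w (b : pbox q N) := multinomial R (bval (val b)) / (mdeg (bval (val b)))%:R
    * t (bval (val b)).
pose cb (b : pbox q N) := \prod_j c j ^+ (val b j).
pose d (b : pbox q N) := mdeg (bval (val b)).
have d0 b : (0 < d b)%N by exact/mdeg_gt0/bval_pbox_neq0.
rewrite -(coef_eq_mod (exp_trunc_sum N _) (leqnn N)); last first.
  by move=> i _; exact: dvdX_scaleXn.
have -> : \sum_(i < N) (p i.+1 / i.+1%:R) *: 'X^(i.+1) =
    \sum_(b : pbox q N | (d b <= N)%N) (w b * cb b) *: 'X^(d b).
  transitivity (\sum_(i < N) \sum_(b : pbox q N | d b == i.+1)
       (w b * cb b) *: 'X^(d b) : {poly R}); last first.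
    rewrite (exchange_big_dep (fun b => d b <= N)%N)/=; last first.
      by move=> i b _ /eqP ->.
    apply: eq_bigr => b dN.
    have dN' : ((d b).-1 < N)%N by rewrite prednK.
    rewrite (big_pred1 (Ordinal dN'))// => i /=.
    by rewrite -val_eqE/= -[in RHS]eqSS prednK// eq_sym.
  apply: eq_bigr => i _; rewrite pE//.
  transitivity (\sum_(a : box q N | mdeg (bval a) == i.+1)
     (multinomial R (bval a) * \prod_j c j ^+ a j * t (bval a) / i.+1%:R) *:
       'X^(i.+1) : {poly R}).
    by rewrite -scaler_suml mulr_suml.
  rewrite (reindex_omap (fun b : pbox q N => val b) insub)/=; last first.
    move=> a /eqP ai; have a0 : a != [ffun=> ord0].
      apply/eqP => a0; move: ai; rewrite a0 mdeg_bval big1// => j _.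
      by rewrite ffunE.
    by rewrite (insubT (fun a : box q N => a != [ffun=> ord0]) a0).
  apply: eq_big => [b|b /andP[/eqP db _]]; last first.
    by rewrite /d db /w db; congr (_ *: _); rewrite /cb; ring.
  by rewrite valK eqxx andbT.
(* The terms of degree above N vanish modulo X^(N+1) and can be put back in. *)
rewrite -(coef_eq_mod (@exp_trunc_eq_mod _ N
    (\sum_b (w b * cb b) *: 'X^(d b)) _ _) (leqnn N)); last first.
  rewrite (bigID (fun b => d b <= N)%N)/= addrAC subrr add0r.
  apply: (big_ind (fun r => 'X^(N.+1) %| r)) => [|r s|b].
  - exact: dvdp0.
  - exact: dvdp_add.
  rewrite -ltnNge -mul_polyC => Nb.
  by rewrite dvdp_mull// dvdp_Pexp2l ?size_polyX.
rewrite (coef_eq_mod (exp_trunc_sum N _) (leqnn N)); last first.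
  by move=> i _; exact: dvdX_scaleXn.
rewrite coef_prod_exp_trunc.
(* For A of total degree N, the entries are at most N, so [inord] keeps them. *)
pose tot (A : {ffun pbox q N -> 'I_N.+1}) : box q N :=
  [ffun j => inord (\sum_b A b * val b j)%N].
pose W (A : {ffun pbox q N -> 'I_N.+1}) := \prod_b (w b ^+ A b / (A b)`!%:R).
have sumE (A : {ffun pbox q N -> 'I_N.+1}) :
    (\sum_b A b * d b = \sum_j \sum_b A b * val b j)%N.
  rewrite exchange_big/=; apply: eq_bigr => b _.
  by rewrite -big_distrr/= /d mdeg_bval.
have totE (A : {ffun pbox q N -> 'I_N.+1}) : (\sum_b A b * d b == N)%N ->
    forall j, tot A j = (\sum_b A b * val b j)%N :> nat.
  move=> /eqP; rewrite sumE => AN j; rewrite ffunE inordK//.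
  by rewrite ltnS -[leqRHS]AN [leqRHS](bigD1 j)//= leq_addr.
rewrite (partition_big tot (fun m => mdeg (bval m) == N))/=; last first.
  move=> A AN; rewrite mdeg_bval; under eq_bigr do rewrite totE//.
  by rewrite -sumE.
apply: eq_bigr => m /eqP mN.
rewrite (chromatic_cycle_index_pbox t mN).
transitivity (\prod_j c j ^+ m j * \sum_(A : {ffun pbox q N -> 'I_N.+1} |
   [forall j, (\sum_b A b * val b j == bval m j)%N]) W A).
  rewrite mulr_sumr; apply: eq_big => A.
    apply/andP/forallP => [[AN /eqP Am] j|Am].
      by rewrite ffunE -totE// Am.
    have AN : (\sum_b A b * d b == N)%N.
      rewrite sumE; apply/eqP; rewrite -[RHS]mN.
      by apply: eq_bigr => j _; exact/eqP.
    split=> //; apply/eqP/ffunP => j; apply: val_inj.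
    by rewrite /= totE// (eqP (Am j)) ffunE.
  move=> /andP[AN /eqP <-].
  have -> : \prod_j c j ^+ tot A j = \prod_b cb b ^+ A b.
    under eq_bigr do rewrite totE// -prodrXr.
    rewrite exchange_big/=; apply: eq_bigr => b _; rewrite /cb -prodrXl.
    by apply: eq_bigr => j _; rewrite mulnC exprM.
  rewrite -big_split/=; apply: eq_bigr => b _.
  by rewrite exprMn mulrA [cb b ^+ _ * _]mulrC.
congr (_ * _); rewrite /W /w mulrA.
rewrite /multinomial mN mulrA divfK ?divff ?mul1r//.
by rewrite pnatr_eq0 -lt0n /mfact prodn_gt0// => j; rewrite fact_gt0.
Qed.

(** * Linear independence of monomials *)

(** Uniqueness of digits in base b, read off modulo b. *)
Lemma digits_inj (b q : nat) (f g : 'I_q -> nat) :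
  (forall j, (f j < b)%N) -> (forall j, (g j < b)%N) ->
  (\sum_j f j * b ^ j = \sum_j g j * b ^ j)%N -> f =1 g.
Proof.
elim: q f g => [|q IH] f g fb gb; first by move=> _ [].
rewrite !big_ord_recl !expn0 !muln1.
have recl h : (\sum_(i < q) h (lift ord0 i) * b ^ bump 0 i =
    (\sum_(i < q) h (lift ord0 i) * b ^ i) * b)%N.
  rewrite big_distrl/=; apply: eq_bigr => i _.
  by rewrite /bump add1n expnSr mulnA.
rewrite !recl => fg.
have fg0 : f ord0 = g ord0.
  have := congr1 (modn ^~ b) fg.
  by rewrite /= !(addnC (_ ord0)) !modnMDl !modn_small.
move: fg; rewrite fg0 => /addnI/eqP.
rewrite eqn_pmul2r; last exact: leq_ltn_trans (fb ord0).
move=> /eqP fgE j; have [k ->|->//] := unliftP ord0 j.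
exact: (IH (fun i => f (lift ord0 i)) (fun i => g (lift ord0 i))).
Qed.

Lemma horner_eq0_poly0 (R : numDomainType) (p : {poly R}) :
  (forall x, p.[x] = 0) -> p = 0.
Proof.
move=> p0; apply: (@roots_geq_poly_eq0 _ _ [seq i%:R | i <- iota 0 (size p)]).
- by apply/allP => x _; apply/eqP.
- by rewrite map_inj_uniq ?iota_uniq//; exact: mulrIn (oner_neq0 _).
- by rewrite size_map size_iota.
Qed.

(** Kronecker substitution: c_j = s^((N+1)^j) turns the monomials with
exponents at most N into pairwise distinct powers of s, so that a polynomial
identity in several variables becomes one in a single variable. *)
Lemma monomials_free (R : numDomainType) (q N : nat) (u v : box q N -> R) :
  (forall c : 'I_q -> R,
    \sum_(m : box q N) (\prod_j c j ^+ m j) * u m =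
    \sum_(m : box q N) (\prod_j c j ^+ m j) * v m) ->
  u =1 v.
Proof.
move=> uv m; apply/eqP; rewrite -subr_eq0; apply/eqP.
pose code (m : box q N) := (\sum_j m j * N.+1 ^ j)%N.
have code_inj : injective code.
  move=> m1 m2 /digits_inj m12; apply/ffunP => j; apply: val_inj.
  by apply: m12 => i.
pose P : {poly R} := \sum_(m : box q N) (u m - v m) *: 'X^(code m).
have /(congr1 (fun p : {poly R} => p`_(code m))) : P = 0.
  apply: horner_eq0_poly0 => s; rewrite horner_sum.
  transitivity (
    \sum_(m : box q N) (\prod_(j < q) (s ^+ (N.+1 ^ j)%N) ^+ m j) * u m -
    \sum_(m : box q N) (\prod_(j < q) (s ^+ (N.+1 ^ j)%N) ^+ m j) * v m).
    rewrite -sumrB; apply: eq_bigr => l _; rewrite -mulrBr hornerZ hornerXn.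
    rewrite mulrC /code -prodrXr; congr (_ * _); apply: eq_bigr => j _.
    by rewrite -exprM mulnC.
  by rewrite (uv (fun j => s ^+ (N.+1 ^ j)%N)) subrr.
rewrite coef0 coef_sum (bigD1 m)//= coefZ coefXn eqxx mulr1.
rewrite big1 ?addr0// => l lm.
rewrite coefZ coefXn; case: eqP => [/code_inj ml|_]; last by rewrite mulr0.
by rewrite ml eqxx in lm.
Qed.

(** * Bounded measurable functions *)

Section bounded_measurable.
Context {R : realType} d {T : measurableType d}.
Implicit Types f g : T -> R.

Definition bounded_measurable f :=
  measurable_fun [set: T] f /\ exists C, forall x, `|f x| <= C.

Lemma bounded_measurable_cst c : bounded_measurable (fun=> c).
Proof. by split => //; exists `|c|. Qed.

Lemma bounded_measurableD f g : bounded_measurable f -> bounded_measurable g ->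
  bounded_measurable (fun x => f x + g x).
Proof.
move=> [mf [C fC]] [mg [C' gC']]; split; first exact: measurable_funD.
by exists (C + C') => x; rewrite (le_trans (ler_normD _ _))// lerD.
Qed.

Lemma bounded_measurableM f g : bounded_measurable f -> bounded_measurable g ->
  bounded_measurable (fun x => f x * g x).
Proof.
move=> [mf [C fC]] [mg [C' gC']]; split; first exact: measurable_funM.
by exists (C * C') => x; rewrite normrM ler_pM.
Qed.

Lemma bounded_measurableX f n : bounded_measurable f ->
  bounded_measurable (fun x => f x ^+ n).
Proof.
move=> bf; elim: n => [|n IH].
  under [X in bounded_measurable X]eq_fun do rewrite expr0.
  exact: bounded_measurable_cst.
under [X in bounded_measurable X]eq_fun do rewrite exprS.
exact: bounded_measurableM.
Qed.

Lemma bounded_measurable_norm f : bounded_measurable f ->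
  bounded_measurable (fun x => `|f x|).
Proof.
move=> [mf [C fC]]; split; first exact: measurableT_comp.
by exists C => x; rewrite normr_id.
Qed.

Lemma bounded_measurableB f g : bounded_measurable f -> bounded_measurable g ->
  bounded_measurable (fun x => f x - g x).
Proof.
move=> [mf [C fC]] [mg [C' gC']]; split; first exact: measurable_funB.
by exists (C + C') => x; rewrite (le_trans (ler_normB _ _))// lerD.
Qed.

Lemma bounded_measurable_dist f g : bounded_measurable f ->
  bounded_measurable g -> bounded_measurable (fun x => `|f x - g x|).
Proof. by move=> bf bg; exact/bounded_measurable_norm/bounded_measurableB. Qed.

Lemma bounded_measurable_sum (I : Type) (r : seq I) (P : pred I)
    (F : I -> T -> R) :
  (forall i, bounded_measurable (F i)) ->
  bounded_measurable (fun x => \sum_(i <- r | P i) F i x).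
Proof.
move=> bF; elim: r => [|i r IH].
  under [X in bounded_measurable X]eq_fun do rewrite big_nil.
  exact: bounded_measurable_cst.
under [X in bounded_measurable X]eq_fun do rewrite big_cons.
by case: (P i) => //; exact: bounded_measurableD.
Qed.

Lemma bounded_measurable_prod (I : Type) (r : seq I) (P : pred I)
    (F : I -> T -> R) :
  (forall i, bounded_measurable (F i)) ->
  bounded_measurable (fun x => \prod_(i <- r | P i) F i x).
Proof.
move=> bF; elim: r => [|i r IH].
  under [X in bounded_measurable X]eq_fun do rewrite big_nil.
  exact: bounded_measurable_cst.
under [X in bounded_measurable X]eq_fun do rewrite big_cons.
by case: (P i) => //; exact: bounded_measurableM.
Qed.

Variable mu : {finite_measure set T -> \bar R}.

Lemma bounded_measurable_integrable f : bounded_measurable f ->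
  mu.-integrable [set: T] (EFin \o f).
Proof.
move=> [mf [C fC]]; apply: measurable_bounded_integrable => //.
  by rewrite ltey_eq fin_num_measure.
exists C; split; first exact: num_real.
by move=> y Cy x _; rewrite /= (le_trans (fC x))// ltW.
Qed.

Lemma Rintegral_sum (I : Type) (r : seq I) (P : pred I) (F : I -> T -> R) :
  (forall i, bounded_measurable (F i)) ->
  \int[mu]_x (\sum_(i <- r | P i) F i x) = \sum_(i <- r | P i) \int[mu]_x F i x.
Proof.
move=> bF; elim: r => [|i r IH].
  rewrite big_nil -[RHS](mul0r (fine (mu [set: T]))) -Rintegral_cst//.
  by apply: eq_Rintegral => x _; rewrite big_nil.
rewrite big_cons -IH; case: ifPn => Pi.
  rewrite -RintegralD//; last 2 first.
  - exact: bounded_measurable_integrable.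
  - exact/bounded_measurable_integrable/bounded_measurable_sum.
  by apply: eq_Rintegral => x _; rewrite big_cons Pi.
by apply: eq_Rintegral => x _; rewrite big_cons (negbTE Pi).
Qed.

(** Dominated convergence with a constant bound, integrable as mu is finite.
*)
Lemma bounded_convergence (f_ : nat -> T -> R) f C :
  (forall n, measurable_fun [set: T] (f_ n)) ->
  (forall n x, `|f_ n x| <= C) ->
  (forall x, f_ ^~ x @ \oo --> f x) ->
  \int[mu]_x f_ n x @[n --> \oo] --> \int[mu]_x f x.
Proof.
move=> mf_ f_C f_f.
have mf : measurable_fun [set: T] f.
  by apply: (measurable_fun_cvg (h := f_)) => // x _; exact: f_f.
have [] := @dominated_convergence _ T R mu setT measurableT
  (fun n => EFin \o f_ n) (EFin \o f) (cst C%:E).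
- by move=> n; exact/measurable_EFinP.
- exact/measurable_EFinP.
- by apply: aeW => x _; apply/fine_cvgP; split; [exact: nearW|exact: f_f].
- exact: finite_measure_integrable_cst.
- by apply: aeW => x n _; rewrite lee_fin.
move=> intf _ /=.
have -> : (\int[mu]_x (EFin \o f) x)%E = (\int[mu]_x f x)%:E.
  by rewrite /Rintegral fineK//; exact: integrable_fin_num.
by move=> /fine_cvgP[].
Qed.

End bounded_measurable.

(** If the coefficients before e_k vanish, dividing the series by s^k shows
that |e_k| is at most the tail sum, which is O(s) because the e_n are bounded
(the series converges at s = 1); let s tend to 0. *)
Lemma power_series_eq0 (R : realType) (e : nat -> R) :
  (forall s, series (fun n => e n * s ^+ n) @ \oo --> 0) -> forall n, e n = 0.
Proof.
move=> e0.
have [B B0 eB] : exists2 B, 0 <= B & forall n, `|e n| <= B.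
  have cve : e @ \oo --> 0.
    apply: cvg_series_cvg_0; apply/cvg_ex; exists 0.
    by have := e0 1; under eq_fun do rewrite expr1n mulr1.
  have /cvg_seq_bounded[C [_ Ce]] : cvgn e by apply/cvg_ex; exists 0.
  exists (`|C| + 1) => [|n].
    by rewrite addr_ge0.
  by apply: Ce => //; rewrite ltr_pwDr// ler_norm.
elim/ltn_ind => k IH.
have key s : 0 < s -> s <= 2^-1 -> `|e k| <= 2 * B * s.
  move=> s0 s2.
  (* The terms after e_k are bounded by a geometric series of ratio 1/2. *)
  have tail m : `|e k| * s ^+ k <=
      `|series (fun n => e n * s ^+ n) (k.+1 + m)%N| +
      2 * B * s ^+ k.+1.
    have -> : series (fun n => e n * s ^+ n) (k.+1 + m)%N =
        e k * s ^+ k + \sum_(i < m) e (k.+1 + i)%N * s ^+ (k.+1 + i).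
      rewrite /series/= big_mkord big_split_ord/= big_ord_recr/=.
      by rewrite big1 ?add0r// => i _; rewrite IH ?mul0r.
    set t := \sum_(i < m) _.
    have tB : `|t| <= 2 * B * s ^+ k.+1.
      rewrite (le_trans (ler_norm_sum _ _ _))//.
      apply: (@le_trans _ _ (\sum_(i < m) B * s ^+ k.+1 * 2^-1 ^+ i)).
        apply: ler_sum => i _; rewrite normrM normrX (ger0_norm (ltW s0)).
        rewrite exprD mulrA ler_pM//.
        - by rewrite mulr_ge0// exprn_ge0// ltW.
        - by rewrite exprn_ge0// ltW.
        - by rewrite ler_wpM2r// exprn_ge0// ltW.
        - by rewrite lerXn2r// nnegrE ltW.
      rewrite -mulr_sumr -[leRHS]mulrA [leRHS]mulrC ler_wpM2l//.
        by rewrite mulr_ge0// exprn_ge0// ltW.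
      have /(congr1 (fun x => 2 * x)) := subrX1 (2^-1 : R) m.
      have : 0 <= 2^-1 ^+ m :> R by rewrite exprn_ge0.
      lra.
    have -> : `|e k| * s ^+ k = `|(e k * s ^+ k + t) - t|.
      by rewrite addrK normrM (ger0_norm (exprn_ge0 k (ltW s0))).
    by rewrite (le_trans (ler_normB _ _))// lerD2l.
  have s0k : 0 < s ^+ k by rewrite exprn_gt0.
  rewrite -(ler_pM2r s0k) -[leRHS]mulrA -exprS.
  rewrite -[leRHS]add0r -(normr0 R).
  have cv : `|series (fun n => e n * s ^+ n) (k.+1 + m)%N| + 2 * B * s ^+ k.+1
      @[m --> \oo] --> `|0 : R| + 2 * B * s ^+ k.+1.
    apply: cvgD; last exact: cvg_cst.
    apply: cvg_norm.
    have := e0 s; rewrite -(cvg_shiftn k.+1); apply: cvg_trans.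
    by under eq_fun do rewrite addnC.
  by apply: (cvgr_to_ge cv); exact: nearW.
apply/eqP; rewrite -normr_le0; apply/ler_addgt0Pr => eps eps0; rewrite add0r.
(* The choice of s makes 2 B s at most eps. *)
have s0 : 0 < Num.min 2^-1 (eps / (2 * B + 1)).
  by rewrite lt_min invr_gt0 ltr0n/= divr_gt0// ltr_wpDl// mulr_ge0.
apply: le_trans (key _ s0 _) _; first by rewrite ge_min lexx.
apply: (@le_trans _ _ (2 * B * (eps / (2 * B + 1)))).
  by rewrite ler_wpM2l ?mulr_ge0// ge_min lexx orbT.
rewrite mulrA ler_pdivrMr ?ltr_wpDl ?mulr_ge0//.
by rewrite [leRHS]mulrDr mulr1 [leLHS]mulrC lerDl ltW.
Qed.

(** * Moments from the Fourier transform *)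

Section fourier_moments.
Context {R : realType}.

Lemma normc_ge_Im (z : R[i]) : `|complex.Im z|%:C%C <= `|z|.
Proof.
have := normc_ge_Re (z * 'i%C).
have i1 : `|'i%C| = 1 :> R[i].
  by rewrite normc_def/= expr0n expr1n add0r sqrtr1.
by rewrite ReiNIm normrN normrM i1 mulr1.
Qed.

Lemma Cseries_cvg_additive (p : {additive R[i] -> R}) (u : nat -> R[i])
    (l : R[i]) :
  (forall z, `|p z|%:C%C <= `|z|) ->
  Cseries_cvg_to u l -> series (fun n => p (u n)) @ \oo --> p l.
Proof.
move=> p_le ul; apply/cvgrPdist_lt => e e0.
have e0C : 0 < e%:C%C :> R[i] by rewrite ltcR.
move/cvgrPdist_lt : ul => /(_ _ e0C) ul.
apply: filterS ul => n; rewrite /series/= -raddf_sum -raddfB => ul.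
by rewrite -ltcR (le_lt_trans (p_le _)).
Qed.

(** Real and imaginary parts of i^n, in the form in which they occur in the
power series of the cosine and of the sine. *)
Definition re_i (n : nat) : R := (~~ odd n)%:R * (-1) ^+ n./2.
Definition im_i (n : nat) : R := (odd n)%:R * (-1) ^+ n.-1./2.

Lemma expr_i n : 'i%C ^+ n = (re_i n +i* im_i n)%C :> R[i].
Proof.
elim: n => [|n IH]; first by rewrite expr0 /re_i /im_i/= mul1r mul0r.
rewrite exprS IH /re_i /im_i /= uphalfE negbK.
apply/eqP; rewrite eq_complex/= !mul0r !mul1r sub0r add0r.
case: n {IH} => [|n]/=; first by rewrite !mul0r !mul1r oppr0 !eqxx.
case: (odd n); rewrite ?mul0r ?mul1r ?oppr0 ?eqxx//=.
by rewrite exprS mulN1r eqxx.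
Qed.

Lemma norm_re_i n : `|re_i n| <= 1.
Proof.
rewrite normrM normrX normrN1 expr1n mulr1.
by case: (odd n); rewrite ?normr0 ?normr1.
Qed.

Lemma norm_im_i n : `|im_i n| <= 1.
Proof.
rewrite normrM normrX normrN1 expr1n mulr1.
by case: (odd n); rewrite ?normr0 ?normr1.
Qed.

Lemma re_i_im_i_neq0 n : re_i n = 0 -> im_i n = 0 -> False.
Proof.
move=> r0 i0; have : 'i%C ^+ n != 0 :> R[i] 
  by rewrite expf_neq0// eq_complex/= oner_eq0 andbF.
by rewrite expr_i r0 i0 eqxx.
Qed.

Lemma cvg_re_i_cos (y : R) :
  series (fun n => re_i n * (y ^+ n / n`!%:R)) @ \oo --> cos y.
Proof.
have -> : (fun n => re_i n * (y ^+ n / n`!%:R)) = cos_coeff y.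
  by apply/funext => n; rewrite /re_i /cos_coeff/= -!mulrA.
rewrite cos.unlock; exact: is_cvg_series_cos_coeff.
Qed.

Lemma cvg_im_i_sin (y : R) :
  series (fun n => im_i n * (y ^+ n / n`!%:R)) @ \oo --> sin y.
Proof.
have -> : (fun n => im_i n * (y ^+ n / n`!%:R)) = sin_coeff y.
  by apply/funext => n; rewrite /im_i /sin_coeff/= -!mulrA.
rewrite sin.unlock; exact: is_cvg_series_sin_coeff.
Qed.

(** Gives the constant that dominates the partial sums in [moment_series]. *)
Lemma norm_series_exp (r : nat -> R) (y C : R) n : (forall n, `|r n| <= 1) ->
  `|y| <= C ->
  `|series (fun n => r n * (y ^+ n / n`!%:R)) n| <= expR C.
Proof.
move=> r1 yC; apply: (@le_trans _ _ (series (exp_coeff C) n)); last first.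
  rewrite /expR; apply: nondecreasing_cvgn_le; last first.
    exact: is_cvg_series_exp_coeff.
  apply: nondecreasing_series => k _ _.
  by rewrite exp_coeff_ge0// (le_trans _ yC).
rewrite /series/= (le_trans (ler_norm_sum _ _ _))//; apply: ler_sum => k _.
rewrite normrM -[leRHS]mul1r ler_pM// /exp_coeff/= normrM normrX.
rewrite normfV (ger0_norm (ler0n _ _)) ler_pM2r ?invr_gt0 ?ltr0n ?fact_gt0//.
by rewrite lerXn2r// nnegrE (le_trans _ yC).
Qed.

Context d {T : measurableType d} (D : {finite_measure set T -> \bar R}).
Variables (Y : T -> R) (bY : bounded_measurable Y).

(** Termwise integration. Taking for phi the cosine and the sine expands the
real and imaginary parts of the Fourier transform of the law of Y. *)
Lemma moment_series (r : nat -> R) (phi : R -> R) (s : R) :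
  (forall n, `|r n| <= 1) ->
  (forall y, series (fun n => r n * (y ^+ n / n`!%:R)) @ \oo --> phi y) ->
  series (fun n => r n * ((\int[D]_x (Y x ^+ n)) / n`!%:R) * s ^+ n) @ \oo -->
  \int[D]_x phi (s * Y x).
Proof.
move=> r1 r_phi; have [mY [C YC]] := bY.
pose F n x := r n * ((s * Y x) ^+ n / n`!%:R).
have bF n : bounded_measurable (F n).
  apply: bounded_measurableM; first exact: bounded_measurable_cst.
  apply: bounded_measurableM; last exact: bounded_measurable_cst.
  apply/bounded_measurableX/bounded_measurableM => //.
  exact: bounded_measurable_cst.
have -> : series (fun n => r n * ((\int[D]_x (Y x ^+ n)) / n`!%:R) * s ^+ n) =
    (fun n => \int[D]_x (series (fun n => r n * ((s * Y x) ^+ n / n`!%:R)) n)).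
  apply/funext => n; rewrite [RHS](@Rintegral_sum _ _ _ _ _ _ _ F)//.
  apply: eq_bigr => k _.
  transitivity (r k / k`!%:R * s ^+ k * \int[D]_x (Y x ^+ k)); first by ring.
  rewrite -RintegralZl//; last first.
    exact/bounded_measurable_integrable/bounded_measurableX.
  by apply: eq_Rintegral => x _; rewrite /F exprMn; ring.
apply: (@bounded_convergence _ _ _ _ _ _ (expR (`|s| * C))).
- by move=> n; case: (bounded_measurable_sum (index_iota 0 n) xpredT bF).
- by move=> n x; apply: norm_series_exp => //; rewrite normrM ler_wpM2l.
- by move=> x; exact: r_phi.
Qed.

(** Real and imaginary parts are treated separately: each determines the
coefficients for which [re_i n], respectively [im_i n], does not vanish, and
one of them never does. *)
Lemma fourier_moment (c : nat -> R) :
  (forall s : R, Cseries_cvg_to (fun n => 'i%C ^+ n * (c n * s ^+ n)%:C%C)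
     (Cintegral D (fun x => expi (s * Y x)))) ->
  forall n, \int[D]_x (Y x ^+ n) = n`!%:R * c n.
Proof.
move=> four n; pose m n := \int[D]_x (Y x ^+ n).
suff /eqP : c n - m n / n`!%:R = 0.
  by rewrite subr_eq0 => /eqP ->; rewrite mulrCA divff ?mulr1.
have part (r : nat -> R) (phi : R -> R) :
  (forall n, `|r n| <= 1) ->
  (forall y, series (fun n => r n * (y ^+ n / n`!%:R)) @ \oo --> phi y) ->
  (forall s, series (fun n => r n * c n * s ^+ n) @ \oo -->
    \int[D]_x phi (s * Y x)) ->
  r n * (c n - m n / n`!%:R) = 0.
  move=> r1 rphi rD; move: n; apply: power_series_eq0 => s.
  have := cvgB (rD s) (@moment_series r phi s r1 rphi); rewrite subrr => H.
  apply: (cvg_trans _ (H _)); apply: near_eq_cvg; apply: nearW => k /=.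
  rewrite !fctE /series/= -sumrB; apply: eq_bigr => i _.
  by rewrite -mulrBl -mulrBr.
have re0 : re_i n * (c n - m n / n`!%:R) = 0.
  apply: (part _ cos norm_re_i cvg_re_i_cos) => s.
  have H := Cseries_cvg_additive (@normc_ge_Re R) (four s).
  apply: (cvg_trans _ H); apply: near_eq_cvg; apply: nearW => k /=.
  by apply: eq_bigr => i _; rewrite expr_i/= mulr0 subr0 mulrA.
have im0 : im_i n * (c n - m n / n`!%:R) = 0.
  apply: (part _ sin norm_im_i cvg_im_i_sin) => s.
  have H := Cseries_cvg_additive normc_ge_Im (four s).
  apply: (cvg_trans _ H); apply: near_eq_cvg; apply: nearW => k /=.
  by apply: eq_bigr => i _; rewrite expr_i/= mulr0 add0r mulrA.
move/eqP: re0; rewrite mulf_eq0 => /orP[/eqP re0|/eqP//].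
move/eqP: im0; rewrite mulf_eq0 => /orP[/eqP im0|/eqP//].
by have := re_i_im_i_neq0 re0 im0.
Qed.

End fourier_moments.

(** * Approximation by continuous functions *)

Lemma continuous_borel_measurable (R : realType) (Z : ptopologicalType)
    (h : Z -> R) :
  continuous h -> measurable_fun [set: borel Z] (h : borel Z -> R).
Proof.
move=> /continuousP ch; apply: (measurability _ (RGenOpens.measurableE R)).
move=> _ [_ [a [b ->] <-]]; rewrite setTI; apply: sub_sigma_algebra.
exact/ch/interval_open.
Qed.

Section open_approximation.
Context {R : realType} {X : topologicalType}.
Hypotheses (X_sc : @second_countable X) (X_lc : locally_compact [set: X])
  (X_T2 : hausdorff_space X).

Definition unit_continuous (h : X -> R) :=
  continuous h /\ forall x, 0 <= h x <= 1.

Lemma open_bump (U : set X) x : open U -> U x ->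
  exists h, [/\ unit_continuous h, forall y, ~ U y -> h y = 0 & h x = 1].
Proof.
move=> oU Ux.
have /(_ x (~` U) _ _)/uniform_separatorP :=
  locally_compact_completely_regular (R := R) X_lc X_T2.
move=> /(_ R (open_closedC oU) (fun nUx => nUx Ux)) [f [cf f01 fx fU]].
exists (fun y => 1 - f y); split.
- split; first by move=> y; apply: cvgB; [exact: cvg_cst|exact: cf].
  move=> y; have : f y \in `[0, 1]%R by apply: f01; exists y.
  by rewrite in_itv/= subr_ge0 lerBlDr lerDl => /andP[-> ->].
- by move=> y Uy; rewrite (fU (f y)) ?subrr//; exists y.
- by rewrite (fx (f x)) ?subr0//; exists x.
Qed.

(** Around each point of U, a bump function is >= 1/2 on some set of the
countable basis; choosing one bump function per basis set suffices to cover.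
*)
Lemma open_bump_cover (U : set X) : open U -> exists h : nat -> X -> R,
  [/\ forall n, unit_continuous (h n), forall n y, ~ U y -> h n y = 0 &
      forall y, U y -> exists n, 2^-1 <= h n y].
Proof.
move=> oU; have [B Bcount [Bo Bbasis]] := X_sc.
have [num num_inj] : exists num : set X -> nat, {in B &, injective num}.
  by move: Bcount => /countable_injP.
pose good V h := [/\ unit_continuous h, forall y, ~ U y -> h y = 0 &
  forall y, V y -> 2^-1 <= h y].
have /choice[h hP] : forall n, exists h : X -> R,
    [/\ unit_continuous h, forall y, ~ U y -> h y = 0 &
     forall V, B V -> num V = n -> (exists h, good V h) ->
       forall y, V y -> 2^-1 <= h y].
  move=> n.
  (* [n] may number no basis set, or one without a bump function. *)
  have [[V [BV Vn [h [ch hU hV]]]]|noV] :=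
    pselect (exists V, [/\ B V, num V = n & exists h, good V h]).
    exists h; split => // V' BV' V'n _.
    suff -> : V' = V by [].
    by apply: num_inj; rewrite ?inE// Vn.
  exists (fun=> 0); split => //.
    by split; [move=> ?; exact: cvg_cst|move=> ?; rewrite lexx ler01].
  by move=> V BV Vn gV; exfalso; apply: noV; exists V.
exists h; split; first by move=> n; case: (hP n).
  by move=> n; case: (hP n).
move=> y Uy; have [g [[cg g01] gU gy]] := open_bump oU Uy.
have : nbhs y [set z | 2^-1 <= g z].
  by apply: (cvgr_ge _ (cg y)); rewrite gy invf_lt1// ltr1n.
move=> /(Bbasis y)[V [BV Vy] Vg]; exists (num V).
case: (hP (num V)) => _ _ /(_ V BV erefl _ y Vy); apply.
by exists g; split.
Qed.

Lemma unit_continuousM (g h : X -> R) :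
  unit_continuous g -> unit_continuous h ->
  unit_continuous (fun x => g x * h x).
Proof.
move=> [cg g01] [ch h01]; split.
  by move=> x; apply: cvgM; [exact: cg|exact: ch].
move=> x; have /andP[g0 g1] := g01 x; have /andP[h0 h1] := h01 x.
by rewrite mulr_ge0//= mulr_ile1.
Qed.

Lemma unit_continuousC (h : X -> R) : unit_continuous h ->
  unit_continuous (fun x => 1 - h x).
Proof.
move=> [ch h01]; split.
  by move=> x; apply: cvgB; [exact: cvg_cst|exact: ch].
by move=> x; have /andP[h0 h1] := h01 x; rewrite subr_ge0 h1 lerBlDr lerDl h0.
Qed.

Lemma unit_continuous1 : unit_continuous (fun=> 1).
Proof. by split; [move=> x; exact: cvg_cst|move=> x; rewrite ler01 lexx]. Qed.

Lemma unit_continuousX (h : X -> R) n : unit_continuous h ->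
  unit_continuous (fun x => h x ^+ n).
Proof.
move=> uh; elim: n => [|n IH].
  under [X in unit_continuous X]eq_fun do rewrite expr0.
  exact: unit_continuous1.
under [X in unit_continuous X]eq_fun do rewrite exprS.
exact: unit_continuousM.
Qed.

Lemma unit_continuous_prod (I : Type) (r : seq I) (h : I -> X -> R) :
  (forall i, unit_continuous (h i)) ->
  unit_continuous (fun x => \prod_(i <- r) h i x).
Proof.
move=> uh; elim: r => [|i r IH].
  under [X in unit_continuous X]eq_fun do rewrite big_nil.
  exact: unit_continuous1.
under [X in unit_continuous X]eq_fun do rewrite big_cons.
exact: unit_continuousM.
Qed.

(** With h_k the functions of [open_bump_cover], the approximation is 1 -
\prod_(k < m) (1 - h_k)^m: it is 0 outside U, and at a point of U where h_k >=
1/2 it is at least 1 - 2^-m as soon as m > k. *)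
Lemma indic_open_approx (U : set X) : open U -> exists g : nat -> X -> R,
  (forall n, unit_continuous (g n)) /\
  forall x, g n x @[n --> \oo] --> (\1_U x : R).
Proof.
move=> /open_bump_cover[h [uh hU hx]].
exists (fun m x => 1 - \prod_(k < m) (1 - h k x) ^+ m); split.
  move=> m; apply: unit_continuousC; apply: unit_continuous_prod => k.
  exact/unit_continuousX/unit_continuousC.
move=> x; rewrite indicE.
have [/set_mem Ux|/negP Ux] := boolP (x \in U); last first.
  have -> : (fun m => 1 - \prod_(k < m) (1 - h k x) ^+ m) = cst 0.
    apply/funext => m; rewrite big1 ?subrr// => k _.
    by rewrite hU ?subr0 ?expr1n// => Ux'; apply: Ux; exact/mem_set.
  exact: cvg_cst.
have [k hk] := hx _ Ux.
rewrite -[X in _ --> X]subr0; apply: cvgB; first exact: cvg_cst.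
(* The product is squeezed between 0 and 2^-m. *)
have half0 : (2^-1 : R) ^+ m @[m --> \oo] --> 0.
  by apply: cvg_expr; rewrite ger0_norm// invf_lt1// ltr1n.
apply: squeeze_cvgr half0; last exact: cvg_cst.
near=> m.
have km : (k < m)%N by near: m; exact: nbhs_infty_gt.
have h01 i : 0 <= 1 - h i x <= 1 by have [_] := unit_continuousC (uh i).
apply/andP; split.
  by apply: prodr_ge0 => i _; have /andP[] := h01 i => *; rewrite exprn_ge0.
rewrite (bigD1 (Ordinal km))//= -[leRHS]mulr1 ler_pM//.
- by have /andP[] := h01 k => *; rewrite exprn_ge0.
- by apply: prodr_ge0 => i _; have /andP[] := h01 i => *; rewrite exprn_ge0.
- rewrite lerXn2r// ?nnegrE//; first by have /andP[] := h01 k.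
  lra.
- apply: prodr_ile1 => i _; have /andP[h0 h1] := h01 i.
  by rewrite exprn_ge0//= exprn_ile1.
Unshelve. all: by end_near. Qed.

End open_approximation.

Lemma unit_continuous_bounded_measurable (R : realType) (Z : ptopologicalType)
  (h : Z -> R) : unit_continuous h -> bounded_measurable (h : borel Z -> R).
Proof.
move=> [ch h01]; split; first exact: continuous_borel_measurable.
by exists 1 => x; have /andP[h0 h1] := h01 x; rewrite ger0_norm.
Qed.

(** For C >= 0, the projection of a on [-C, C], in a form whose continuity is that of the
absolute value. *)
Definition clip (R : realType) (C a : R) : R := (`|a + C| - `|a - C|) / 2.

Lemma clip_continuous (R : realType) (X : topologicalType) (C : R)
    (g : X -> R) : continuous g ->
  continuous (fun x => clip C (g x)).
Proof.
move=> cg x; apply: cvgM; last exact: cvg_cst.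
by apply: cvgB; apply: cvg_norm; [apply: cvgD|apply: cvgB];
  [exact: cg|exact: cvg_cst|exact: cg|exact: cvg_cst].
Qed.

Lemma clip_le (R : realType) (C a : R) : 0 <= C -> `|clip C a| <= C.
Proof.
move=> C0; rewrite /clip ler_norml.
case: (ger0P (a + C)) => ?; case: (ger0P (a - C)) => ?; apply/andP; split; lra.
Qed.

Lemma dist_clip (R : realType) (C a b : R) :
  `|b| <= C -> `|clip C a - b| <= `|a - b|.
Proof.
rewrite ler_norml => /andP[Cb bC]; rewrite /clip ler_norml.
by case: (ger0P (a + C)) => ?; case: (ger0P (a - C)) => ?;
  case: (ger0P (a - b)) => ?; apply/andP; split; lra.
Qed.

Section density.
Context {R : realType} {X : ptopologicalType}.
Hypotheses (X_sc : @second_countable X) (X_lc : locally_compact [set: X])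
  (X_T2 : hausdorff_space X).
Variable mu : {finite_measure set (borel X) -> \bar R}.

Definition L1dist (f g : borel X -> R) : R := \int[mu]_x `|f x - g x|.

Lemma L1dist_le f g f' g' h k : bounded_measurable f -> bounded_measurable g ->
  bounded_measurable f' -> bounded_measurable g' ->
  bounded_measurable h -> bounded_measurable k ->
  (forall x, `|f x - g x| <= `|f' x - g' x| + `|h x - k x|) ->
  L1dist f g <= L1dist f' g' + L1dist h k.
Proof.
move=> bf bg bf' bg' bh bk fg; rewrite /L1dist -RintegralD//; last 2 first.
- exact/bounded_measurable_integrable/bounded_measurable_dist.
- exact/bounded_measurable_integrable/bounded_measurable_dist.
apply: le_Rintegral => //.
- exact/bounded_measurable_integrable/bounded_measurable_dist.
- apply: bounded_measurable_integrable; apply: bounded_measurableD.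
    exact: bounded_measurable_dist.
  exact: bounded_measurable_dist.
Qed.

Lemma L1dist_triangle f g h : bounded_measurable f -> bounded_measurable g ->
  bounded_measurable h -> L1dist f h <= L1dist f g + L1dist g h.
Proof. by move=> bf bg bh; apply: L1dist_le => // x; exact: ler_distD. Qed.

(** Sets whose indicator is an L^1 limit of continuous functions with values
in [0, 1]; the fixed range makes this class stable under union, through
products of approximants. *)
Definition set_approx (A : set (borel X)) := forall e : R, 0 < e ->
  exists2 g : X -> R, unit_continuous g & L1dist g \1_A <= e.

Lemma indic_bounded_measurable (A : set (borel X)) : measurable A ->
  bounded_measurable (\1_A : borel X -> R).
Proof.
move=> mA; split; first exact: measurable_indic.
by exists 1 => x; rewrite indicE; case: (_ \in _); rewrite ?normr0 ?normr1.
Qed.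

Lemma set_approx_lim (f : nat -> borel X -> R) (A : set (borel X)) :
  measurable A -> (forall n, measurable_fun setT (f n)) ->
  (forall n x, 0 <= f n x <= 1) ->
  (forall x, f n x @[n --> \oo] --> (\1_A x : R)) ->
  forall e, 0 < e -> exists n, L1dist (f n) \1_A <= e.
Proof.
move=> mA mf f01 fA e e0.
have bf n : bounded_measurable (f n).
  split => //; exists 1 => x.
  by have /andP[h0 h1] := f01 n x; rewrite ger0_norm.
have : L1dist (f n) \1_A @[n --> \oo] --> \int[mu]_x (0 : R).
  apply: (@bounded_convergence _ _ _ mu _ _ 2).
  - move=> n; have [] // : bounded_measurable (fun x => `|f n x - \1_A x|).
    exact/bounded_measurable_norm/bounded_measurableB/indic_bounded_measurable.
  - move=> n x; rewrite normr_id indicE; have /andP[] := f01 n x.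
    case: (_ \in _) => /= *; rewrite ler_norml; apply/andP; split; lra.
  - move=> x; rewrite -(normr0 R) -(subrr (\1_A x : R)); apply: cvg_norm.
    by apply: cvgB; [exact: fA|exact: cvg_cst].
rewrite Rintegral_cst// mul0r => /cvgr_le /(_ _ e0)[n _ /(_ n (leqnn n))].
by exists n.
Qed.

Lemma set_approx0 : set_approx set0.
Proof.
move=> e e0; exists (fun=> 0).
  by split; [move=> x; exact: cvg_cst|move=> x; rewrite lexx ler01].
rewrite /L1dist; under eq_Rintegral do rewrite indic0 subrr normr0.
by rewrite Rintegral_cst// mul0r ltW.
Qed.

Lemma set_approx_open (U : set X) : open U -> set_approx U.
Proof.
move=> oU e e0; have [g [ug gU]] := @indic_open_approx R X X_sc X_lc X_T2 U oU.
have mU : measurable (U : set (borel X)) by exact: sub_sigma_algebra.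
have [n gn] := @set_approx_lim g U mU
  (fun n => (unit_continuous_bounded_measurable (ug n)).1)
  (fun n => (ug n).2) gU _ e0.
by exists (g n).
Qed.

Lemma set_approxC (A : set (borel X)) : measurable A -> set_approx A ->
  set_approx (~` A).
Proof.
move=> mA Aa e /Aa[g ug gA]; exists (fun x => 1 - g x).
  exact: unit_continuousC.
rewrite (le_trans _ gA)// /L1dist le_eqVlt; apply/orP; left; apply/eqP.
apply: eq_Rintegral => x _; rewrite !indicE in_setC.
case: (x \in A) => /=; first by rewrite subr0 distrC.
by rewrite addrAC subrr add0r normrN subr0.
Qed.

(** If g and h approximate the indicators, then 1 - (1 - g) (1 - h)
approximates that of the union, and the errors add up since all factors lie in
[0, 1]. *)
Lemma set_approxU (A B : set (borel X)) : measurable A -> measurable B ->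
  set_approx A -> set_approx B -> set_approx (A `|` B).
Proof.
move=> mA mB Aa Ba e e0.
have [g ug gA] := Aa (e / 2) (divr_gt0 e0 (ltr0n _ 2)).
have [h uh hB] := Ba (e / 2) (divr_gt0 e0 (ltr0n _ 2)).
have uk : unit_continuous (fun x => 1 - (1 - g x) * (1 - h x)).
  by apply/unit_continuousC/unit_continuousM; exact: unit_continuousC.
exists (fun x => 1 - (1 - g x) * (1 - h x)) => //.
rewrite [leRHS]splitr (le_trans _ (lerD gA hB))//.
apply: L1dist_le.
- exact: unit_continuous_bounded_measurable.
- exact/indic_bounded_measurable/measurableU.
- exact: unit_continuous_bounded_measurable.
- exact/indic_bounded_measurable.
- exact: unit_continuous_bounded_measurable.
- exact/indic_bounded_measurable.
move=> x; rewrite !indicE in_setU.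
have /andP[g0 g1] := ug.2 x; have /andP[h0 h1] := uh.2 x.
have gh : 0 <= (1 - g x) * (1 - h x) by rewrite mulr_ge0// subr_ge0.
have ghx : 0 <= g x * h x by rewrite mulr_ge0.
have gh' : 0 <= g x * (1 - h x) by rewrite mulr_ge0// subr_ge0.
have hg' : 0 <= (1 - g x) * h x by rewrite mulr_ge0// subr_ge0.
have [nA nA'] :=
  (ler_norm (g x - (x \in A)%:R), ler_norm (- (g x - (x \in A)%:R))).
have [nB nB'] :=
  (ler_norm (h x - (x \in B)%:R), ler_norm (- (h x - (x \in B)%:R))).
rewrite !normrN in nA' nB'; rewrite ler_norml.
by move: nA nA' nB nB'; case: (x \in A); case: (x \in B) => /= *;
  apply/andP; split; lra.
Qed.

(** The approximable measurable sets form a sigma-algebra containing the open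
sets; a countable union is first replaced by a finite one. *)
Lemma set_approx_measurable (A : set (borel X)) : measurable A -> set_approx A.
Proof.
suff : <<s @open X >> `<=`
    [set A : set (borel X) | measurable A /\ set_approx A].
  by move=> H mA; exact: (H A mA).2.
apply: smallest_sub; last first.
  by move=> U oU; split; [exact: sub_sigma_algebra|exact: set_approx_open].
split => /=.
- by split => //; exact: set_approx0.
- move=> A' [mA' Aa']; rewrite setTD; split; first exact: measurableC.
  exact: set_approxC.
suff FU (F : nat -> set (borel X)) :
    (forall n, measurable (F n) /\ set_approx (F n)) ->
    measurable (\bigcup_i F i) /\ set_approx (\bigcup_i F i).
  by move=> F; exact: FU.
move=> mFa; have mF n : measurable (F n) by case: (mFa n).
have mFi n : measurable (\big[setU/set0]_(i < n) F i).
  exact: bigsetU_measurable.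
split; first exact: bigcup_measurable.
have Fi n : set_approx (\big[setU/set0]_(i < n) F i).
  elim: n => [|n IH].
    by rewrite big_ord0; exact: set_approx0.
  by rewrite big_ord_recr/=; exact: set_approxU (mFi n) (mF n) IH (mFa n).2.
move=> e e0.
have [||n Fn] := @set_approx_lim (fun n => \1_(\big[setU/set0]_(i < n) F i))
    (\bigcup_i F i) (bigcup_measurable (fun i _ => mF i))
    (fun n => (indic_bounded_measurable (mFi n)).1) _ _
    (e / 2) (divr_gt0 e0 (ltr0n _ 2)).
- by move=> n x; rewrite indicE; case: (_ \in _); rewrite /= ?lexx ?ler01.
- move=> x; rewrite indicE; have [|nF] := boolP (x \in \bigcup_i F i).
    move=> /set_mem[i _ Fix].
    apply: cvg_near_cst; near=> n; rewrite indicE mem_set// -bigcup_mkord.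
    by exists i => //=; near: n; exact: nbhs_infty_gt.
  apply: cvg_near_cst; apply: nearW => n; rewrite indicE memNset//.
  rewrite -bigcup_mkord => -[i _ Fix]; move/negP: nF; apply.
  by apply/mem_set; exists i.
have [g ug gF] := Fi n (e / 2) (divr_gt0 e0 (ltr0n _ 2)).
exists g => //; rewrite [leRHS]splitr (le_trans _ (lerD gF Fn))//.
apply: L1dist_triangle.
- exact: unit_continuous_bounded_measurable.
- exact: indic_bounded_measurable.
- exact/indic_bounded_measurable/bigcup_measurable.
Unshelve. all: by end_near. Qed.


Definition bounded_continuous (g : X -> R) :=
  continuous g /\ exists C, forall x, `|g x| <= C.

Lemma bounded_continuous_measurable (g : X -> R) : bounded_continuous g ->
  bounded_measurable (g : borel X -> R).
Proof. by move=> [cg gC]; split=> //; exact: continuous_borel_measurable. Qed.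

Definition fun_approx (f : borel X -> R) := forall e : R, 0 < e ->
  exists2 g : X -> R, bounded_continuous g & L1dist g f <= e.

Lemma fun_approx_indic (A : set (borel X)) : measurable A ->
  fun_approx (\1_A : borel X -> R).
Proof.
move=> /set_approx_measurable Aa e /Aa[g [cg g01] gA].
exists g => //; split => //; exists 1 => x.
by have /andP[g0 g1] := g01 x; rewrite ger0_norm.
Qed.

Lemma fun_approxD (f f' : borel X -> R) : bounded_measurable f ->
  bounded_measurable f' -> fun_approx f -> fun_approx f' ->
  fun_approx (fun x => f x + f' x).
Proof.
move=> bf bf' af af' e e0; have e20 : 0 < e / 2 by rewrite divr_gt0.
have [g [cg [C gC]] gf] := af _ e20; have [g' [cg' [C' gC']] gf'] := af' _ e20.
have bc : bounded_continuous (fun x => g x + g' x).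
  split; first by move=> x; apply: cvgD; [exact: cg|exact: cg'].
  by exists (C + C') => x; rewrite (le_trans (ler_normD _ _))// lerD.
exists (fun x => g x + g' x) => //.
rewrite [leRHS]splitr (le_trans _ (lerD gf gf'))//; apply: L1dist_le => //.
- exact: bounded_continuous_measurable.
- exact: bounded_measurableD.
- by apply: bounded_continuous_measurable; split => //; exists C.
- by apply: bounded_continuous_measurable; split => //; exists C'.
by move=> x; rewrite opprD addrACA ler_normD.
Qed.

Lemma fun_approxZ (c : R) (f : borel X -> R) : bounded_measurable f ->
  fun_approx f -> fun_approx (fun x => c * f x).
Proof.
move=> bf af e e0; have e0' : 0 < e / (`|c| + 1) by rewrite divr_gt0// ltr_wpDl.
have [g [cg [C gC]] gf] := af _ e0'.
exists (fun x => c * g x).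
  split; first by move=> x; apply: cvgM; [exact: cvg_cst|exact: cg].
  by exists (`|c| * C) => x; rewrite normrM ler_wpM2l.
have -> : L1dist (fun x => c * g x) (fun x => c * f x) = `|c| * L1dist g f.
  rewrite /L1dist -RintegralZl//.
    by apply: eq_Rintegral => x _; rewrite -mulrBr normrM.
  apply: bounded_measurable_integrable; apply: bounded_measurable_norm.
  apply: bounded_measurableB => //.
  by apply: bounded_continuous_measurable; split => //; exists C.
rewrite (@le_trans _ _ (`|c| * (e / (`|c| + 1))))// ?ler_wpM2l//.
rewrite mulrA ler_pdivrMr ?ltr_wpDl//.
by rewrite [leRHS]mulrDr mulr1 [leLHS]mulrC lerDl ltW.
Qed.

Lemma fun_approx_sum (I : Type) (r : seq I) (F : I -> borel X -> R) :
  (forall i, bounded_measurable (F i)) -> (forall i, fun_approx (F i)) ->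
  fun_approx (fun x => \sum_(i <- r) F i x).
Proof.
move=> bF aF; elim: r => [|i r IH].
  under [X in fun_approx X]eq_fun do rewrite big_nil.
  move=> e e0; exists (fun=> 0).
    by split; [move=> ?; exact: cvg_cst|exists 0 => x; rewrite normr0].
  rewrite /L1dist; under eq_Rintegral do rewrite subrr normr0.
  by rewrite Rintegral_cst// mul0r ltW.
under [X in fun_approx X]eq_fun do rewrite big_cons.
by apply: fun_approxD => //; exact: bounded_measurable_sum.
Qed.

Import HBSimple.

Lemma fun_approx_sfun (s : {sfun borel X >-> R}) : fun_approx s.
Proof.
have -> : (s : borel X -> R) = (fun x => \sum_(y <- fset_set (range s))
    y * (\1_(s @^-1` [set y]) x : R)).
  by apply/funext => x; rewrite fimfunE fsbig_finite.
have ms y : measurable (s @^-1` [set y]) by [].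
apply: fun_approx_sum => y.
  apply: bounded_measurableM; first exact: bounded_measurable_cst.
  exact: indic_bounded_measurable.
apply: fun_approxZ; first exact: indic_bounded_measurable.
exact: fun_approx_indic.
Qed.

(** Approximate f by a simple function, the latter by a bounded continuous
one, and clip the result, which keeps the bound C and does not increase the
distance. *)
Lemma bounded_continuous_dense (f : borel X -> R) (C : R) :
  measurable_fun setT f -> (forall x, `|f x| <= C) ->
  forall e, 0 < e -> exists g : X -> R,
    [/\ continuous g, forall x, `|g x| <= C & L1dist g f <= e].
Proof.
move=> mf fC e e0; have bf : bounded_measurable f by split => //; exists C.
have C0 : 0 <= C by rewrite (le_trans _ (fC point)).
have e20 : 0 < e / 2 by rewrite divr_gt0.
have [s [_ _ sf]] := approximation_sfun_integrable measurableT
  (bounded_measurable_integrable mu bf).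
have bs n : bounded_measurable (s n).
  split => //; have [M [_ Ms]] := simple_bounded (s n).
  by exists (M + 1) => x; apply: Ms => //; rewrite ltrDl.
have [n sn] : exists n, L1dist (s n) f <= e / 2.
  move/fine_cvgP : sf => [_ /cvgr_le /(_ _ e20)[n _ /(_ n (leqnn n)) sn]].
  exists n; apply: le_trans sn; rewrite le_eqVlt; apply/orP; left; apply/eqP.
  by congr fine; apply: eq_integral => x _; rewrite /= distrC.
have [g [cg [C' gC']] gs] := fun_approx_sfun (s n) e20.
exists (fun x => clip C (g x)); split; first exact: clip_continuous.
  by move=> x; exact: clip_le.
have bg : bounded_measurable (g : borel X -> R).
  by apply: bounded_continuous_measurable; split => //; exists C'.
have bcg : bounded_measurable ((fun x => clip C (g x)) : borel X -> R).
  apply: bounded_continuous_measurable; split; first exact: clip_continuous.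
  by exists C => x; exact: clip_le.
rewrite [leRHS]splitr (le_trans _ (lerD gs sn))//.
rewrite (le_trans _ (L1dist_triangle bg (bs n) bf))//.
apply: le_Rintegral => //.
- exact/bounded_measurable_integrable/bounded_measurable_dist.
- exact/bounded_measurable_integrable/bounded_measurable_dist.
- by move=> x _; exact: dist_clip.
Qed.

End density.

(** * The measurable structure of the space of probability measures *)

Section narrow.
Context {R : realType} {X : ptopologicalType}.
Local Notation PX := (borel (narrow X R)).

(** Makes the probability underlying a point of [borel (narrow X R)] visible
to the inference of measure structures. *)
Definition as_probability (eta : PX) : probability (borel X) R := eta.

Lemma fine_as_probability (eta : PX) :
  fine (as_probability eta [set: borel X]) = 1.
Proof. by have /= -> := @probability_setT _ _ _ (as_probability eta). Qed.

Lemma norm_integral_le (eta : PX) (h : borel X -> R) (C : R) :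
  bounded_measurable h -> (forall x, `|h x| <= C) ->
  `|\int[as_probability eta]_x h x| <= C.
Proof.
move=> bh hC; rewrite (le_trans (le_normr_Rintegral _ _))//.
  exact: bounded_measurable_integrable.
have -> : C = \int[as_probability eta]_x (cst C x).
  by rewrite Rintegral_cst// fine_as_probability mulr1.
apply: le_Rintegral => //.
- exact/bounded_measurable_integrable/bounded_measurable_norm.
- exact/bounded_measurable_integrable/bounded_measurable_cst.
Qed.

Lemma narrow_integral_continuous (g : X -> R) : continuous g -> bounded_fun g ->
  continuous (fun eta : narrow X R =>
    \int[(eta : probability (borel X) R)]_x (g : borel X -> R) x).
Proof.
move=> cg bg; pose G : {classic (Cb X R)} := exist _ g (conj cg bg).
(* The narrow topology is induced by F, so evaluation at G is continuous. *)
pose F := (fun eta : probability (borel X) R =>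
  (fun f : Cb X R => \int[eta]_x sval f x) : {ptws Cb X R -> R}).
have cF : continuous (F : narrow X R -> {ptws Cb X R -> R}).
  exact: initial_continuous.
have cG : continuous ((fun h => h G) : {ptws Cb X R -> R} -> R).
  exact: (@proj_continuous {classic (Cb X R)} (fun=> R) G).
move=> eta; exact: (continuous_comp (cF eta) (cG _)).
Qed.

Lemma bounded_continuous_bounded (g : X -> R) : bounded_continuous g ->
  bounded_fun g.
Proof.
move=> [_ [C gC]]; exists C; split; first exact: num_real.
by move=> y Cy x _; rewrite /= (le_trans (gC x))// ltW.
Qed.

Lemma measurable_integral_bounded_continuous (g : X -> R) :
  bounded_continuous g ->
  measurable_fun [set: PX]
    (fun eta : PX => \int[as_probability eta]_x (g : borel X -> R) x).
Proof.
move=> bg; apply: continuous_borel_measurable.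
apply: narrow_integral_continuous; first by case: bg.
exact: bounded_continuous_bounded.
Qed.

Hypotheses (X_sc : @second_countable X) (X_lc : locally_compact [set: X])
  (X_T2 : hausdorff_space X).

(** Narrow open sets only make integrals of bounded continuous functions
measurable in eta. This passes to open sets by bounded limits, and from there
to Borel sets because those with the property form a lambda-system. *)
Lemma measurable_eval (A : set (borel X)) : measurable A ->
  measurable_fun [set: PX] (fun eta : PX => as_probability eta A).
Proof.
move: A; apply: (@dynkin_induction _ (borel X) (@open X)) => //.
- exact: openI.
- by apply: (eq_measurable_fun (cst 1%E)) => // eta _; rewrite probability_setT.
- move=> U oU; have [g [ug gU]] := @indic_open_approx R X X_sc X_lc X_T2 U oU.
  have mU : measurable (U : set (borel X)) by exact: sub_sigma_algebra.
  apply: (eq_measurable_fun (fun eta : PX =>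
      (\int[as_probability eta]_x (\1_U x : R))%:E)).
    move=> eta _; rewrite /Rintegral integral_indic// setIT fineK//.
    exact: fin_num_measure.
  apply/measurable_EFinP.
  apply: (@measurable_fun_cvg _ _ R setT (fun n (eta : PX) =>
      \int[as_probability eta]_x (g n : borel X -> R) x)).
    move=> n; apply: measurable_integral_bounded_continuous.
    case: (ug n) => cg g01; split => //; exists 1 => x.
    by have /andP[g0 g1] := g01 x; rewrite ger0_norm.
  move=> eta _; apply: (@bounded_convergence _ _ _ _ _ _ 1) => // [n|n x].
    by case: (unit_continuous_bounded_measurable (ug n)).
  by have /andP[g0 g1] := (ug n).2 x; rewrite ger0_norm.
- move=> S mS HS; apply: (eq_measurable_fun (fun eta : PX =>
      1 - as_probability eta S)%E).
    by move=> eta _; rewrite probability_setC.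
  exact: emeasurable_funB.
- move=> F mF tF HF; apply: (eq_measurable_fun (fun eta : PX =>
      \sum_(0 <= k <oo) as_probability eta (F k))%E).
    by move=> eta _; rewrite measure_semi_bigcup//; exact: bigcup_measurable.
  exact: ge0_emeasurable_sum.
Qed.

Definition giry_of (eta : PX) : giry (borel X) R := as_probability eta.

Lemma measurable_giry_of : measurable_fun [set: PX] giry_of.
Proof.
by apply: measurable_giry_codensity => // B mB; exact: measurable_eval.
Qed.

(** The intensity measure A |-> \int eta(A) dD(eta). *)
Definition mean_measure (D : probability PX R) : giry (borel X) R :=
  giry_bind D measurable_giry_of.

(** Adding the bound C makes the integrand nonnegative, and the integral of a
nonnegative function is measurable in the measure, as a monotone limit. *)
Lemma bounded_measurable_integral (f : borel X -> R) : bounded_measurable f ->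
  bounded_measurable (fun eta : PX => \int[as_probability eta]_x f x).
Proof.
move=> bf; have [mf [C fC]] := bf; split; last first.
  by exists C => eta; exact: norm_integral_le.
apply: (eq_measurable_fun (fun eta : PX =>
    fine (\int[as_probability eta]_x (f x + C)%:E)%E - C)).
  move=> eta _.
  transitivity (\int[as_probability eta]_x (f x + C) - C); first by [].
  rewrite RintegralD//; last 2 first.
  - exact: bounded_measurable_integrable.
  - exact/bounded_measurable_integrable/bounded_measurable_cst.
  by rewrite Rintegral_cst// fine_as_probability mulr1 addrK.
apply: measurable_funB => //; apply: measurableT_comp => //.
apply: (@measurable_fun_integral_kernel _ _ _ _ _ (fun eta : PX =>
    (as_probability eta : {measure set _ -> \bar R}))).
- by move=> U mU; exact: measurable_eval.
- move=> x; rewrite lee_fin -lerBlDr sub0r.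
  by have := fC x; rewrite ler_norml => /andP[].
- by apply/measurable_EFinP; exact: measurable_funD.
Qed.

Lemma mean_measureE (D : probability PX R) (f : borel X -> R) :
  bounded_measurable f -> (forall x, 0 <= f x) ->
  \int[mean_measure D]_x f x = \int[D]_eta \int[as_probability eta]_x f x.
Proof.
move=> bf f0; rewrite /Rintegral; congr fine.
have := giry_int_bind (D : giry PX R) measurable_giry_of (h := EFin \o f).
rewrite /giry_int /= => ->; last 2 first.
- by apply/measurable_EFinP; case: bf.
- by move=> x; rewrite lee_fin.
apply: eq_integral => eta _; rewrite fineK//.
exact/integrable_fin_num/bounded_measurable_integrable.
Qed.

End narrow.

(** * Moments of one linear functional *)

(** Z_n is homogeneous of degree n when t_k has weight k, by the constraint
\sum_i i l_i = n on cycle types. *)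
Lemma cycle_index_homogeneous (R : realType) n (s : R) (t t' : nat -> R) :
  (forall k, t' k = s ^+ k * t k) ->
  cycle_index n t' = s ^+ n * cycle_index n t.
Proof.
move=> tE; rewrite /cycle_index !fsbig_finite; [|exact: cycle_type_finite..].
rewrite mulr_sumr; rewrite !big_seq; apply: eq_bigr => l.
rewrite in_fset_set; last exact: cycle_type_finite.
move=> /set_mem ln.
have -> : s ^+ n = \prod_(i < n) s ^+ (i.+1 * l i).
  by rewrite prodrXr (_ : (\sum_(i < n) i.+1 * l i)%N = n).
rewrite -big_split/=.
apply: eq_bigr => i _; rewrite tE exprMn mulrA -exprM.
by [].
Qed.

Lemma cvg_seq_sum (R : realType) (I : Type) (r : seq I) (F : nat -> I -> R)
    (l : I -> R) : (forall i, F m i @[m --> \oo] --> l i) ->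
  \sum_(i <- r) F m i @[m --> \oo] --> \sum_(i <- r) l i.
Proof.
move=> Fl; elim: r => [|i r IH].
  by under eq_fun do rewrite big_nil; rewrite big_nil; exact: cvg_cst.
by under eq_fun do rewrite big_cons; rewrite big_cons; exact: cvgD.
Qed.

Lemma cvg_seq_prod (R : realType) (I : Type) (r : seq I) (F : nat -> I -> R)
    (l : I -> R) : (forall i, F m i @[m --> \oo] --> l i) ->
  \prod_(i <- r) F m i @[m --> \oo] --> \prod_(i <- r) l i.
Proof.
move=> Fl; elim: r => [|i r IH].
  by under eq_fun do rewrite big_nil; rewrite big_nil; exact: cvg_cst.
by under eq_fun do rewrite big_cons; rewrite big_cons; exact: cvgM.
Qed.

Lemma cvg_cycle_index (R : realType) n (t_ : nat -> nat -> R) (t : nat -> R) :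
  (forall k, t_ m k @[m --> \oo] --> t k) ->
  cycle_index n (t_ m) @[m --> \oo] --> cycle_index n t.
Proof.
move=> tk; have cE (u : nat -> R) : cycle_index n u =
    \sum_(l <- fset_set (cycle_type n))
      (\prod_(i < n) (u i.+1 ^+ l i / (i.+1%:R ^+ l i * (l i)`!%:R))).
  by rewrite /cycle_index fsbig_finite//; exact: cycle_type_finite.
rewrite cE; under eq_fun do rewrite cE.
apply: cvg_seq_sum => l; apply: cvg_seq_prod => i.
apply: cvgM; last exact: cvg_cst.
exact: (cvg_comp _ _ (tk i.+1) (@exprn_continuous R (l i) (t i.+1))).
Qed.

(** Factor a - b out of a^n - b^n; the cofactor has n terms of size at most
C^(n-1). *)
Lemma dist_exprn (R : realType) (C a b : R) n : `|a| <= C -> `|b| <= C ->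
  `|a ^+ n - b ^+ n| <= (C ^+ n.-1 *+ n) * `|a - b|.
Proof.
move=> aC bC; have C0 : 0 <= C by exact: le_trans aC.
rewrite subrXX normrM mulrC ler_wpM2r// (le_trans (ler_norm_sum _ _ _))//.
rewrite -[X in _ *+ X]card_ord -sumr_const; apply: ler_sum => i _.
rewrite normrM !normrX (@le_trans _ _ (C ^+ (n.-1 - i) * C ^+ i))//.
  apply: ler_pM => //.
  by rewrite lerXn2r// nnegrE.
  by rewrite lerXn2r// nnegrE.
rewrite -exprD subnK// -ltnS prednK//; exact: leq_ltn_trans (ltn_ord i).
Qed.

Lemma dist_Rintegral_exprn (R : realType) d (T : measurableType d)
    (nu : {finite_measure set T -> \bar R}) (u v : T -> R) (C : R) n :
  bounded_measurable u -> bounded_measurable v ->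
  (forall x, `|u x| <= C) -> (forall x, `|v x| <= C) ->
  `|\int[nu]_x (u x ^+ n) - \int[nu]_x (v x ^+ n)| <=
  (C ^+ n.-1 *+ n) * \int[nu]_x `|u x - v x|.
Proof.
move=> bu bv uC vC.
have bun : bounded_measurable (fun x => u x ^+ n) by exact: bounded_measurableX.
have bvn : bounded_measurable (fun x => v x ^+ n) by exact: bounded_measurableX.
have buv : bounded_measurable (fun x => `|u x - v x|).
  exact: bounded_measurable_dist.
have buvn : bounded_measurable (fun x => u x ^+ n - v x ^+ n).
  exact: bounded_measurableB.
rewrite -RintegralB//; [|exact: bounded_measurable_integrable..].
rewrite (le_trans (le_normr_Rintegral _ _))//.
  exact: bounded_measurable_integrable.
rewrite -RintegralZl//; last exact: bounded_measurable_integrable.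
apply: le_Rintegral => //.
- exact/bounded_measurable_integrable/bounded_measurable_norm.
- apply/bounded_measurable_integrable/bounded_measurableM => //.
  exact: bounded_measurable_cst.
- by move=> x _; exact: dist_exprn.
Qed.

Lemma cvg_dist_harmonic (R : realType) (x_ : nat -> R) (x K : R) :
  (forall k, `|x_ k - x| <= K * k.+1%:R^-1) -> x_ @ \oo --> x.
Proof.
move=> xK; apply/subr_cvg0/norm_cvg0P.
have K0 : K * harmonic k @[k --> \oo] --> 0.
  by rewrite -(mulr0 K); apply: cvgM; [exact: cvg_cst|exact: cvg_harmonic].
have z : (fun=> 0 : R) @ \oo --> (0 : R) by exact: cvg_cst.
by apply: (squeeze_cvgr _ z K0); apply: nearW => k /=; rewrite normr_ge0 xK.
Qed.

Section moments.
Context {R : realType} {X : ptopologicalType}.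
Hypotheses (X_sc : @second_countable X) (X_lc : locally_compact [set: X])
  (X_T2 : hausdorff_space X).
Variable alpha : {finite_measure set (borel X) -> \bar R}.
Local Notation PX := (borel (narrow X R)).
Variable D : probability PX R.
Hypothesis D_DF : is_Dirichlet_Ferguson alpha D.

(** The claimed value of the n-th moment of eta |-> eta f. *)
Definition ferguson_moment (f : borel X -> R) n : R :=
  n`!%:R / rising (mass alpha) n *
  cycle_index n (fun k => \int[alpha]_x (f x ^+ k)).

(** By homogeneity of Z_n, the Fourier transform at s g is a power series in s
with coefficients i^n Z_n / <beta>_n; [fourier_moment] compares it with the
moments. *)
Lemma moment_continuous (g : X -> R) n : bounded_continuous g ->
  \int[D]_eta ((\int[as_probability eta]_x (g : borel X -> R) x) ^+ n) =
  ferguson_moment (g : borel X -> R) n.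
Proof.
move=> bg; have [cg [C gC]] := bg; have bmg := bounded_continuous_measurable bg.
have bY := bounded_measurable_integral X_sc X_lc X_T2 bmg.
rewrite (@fourier_moment R _ _ D _ bY (fun n => (rising (mass alpha) n)^-1 *
    cycle_index n (fun k => \int[alpha]_x ((g : borel X -> R) x ^+ k)))).
  by rewrite /ferguson_moment mulrA.
move=> s; have bsg : bounded_continuous (fun x => s * g x).
  split; first by move=> x; apply: cvgM; [exact: cvg_cst|exact: cg].
  by exists (`|s| * C) => x; rewrite normrM ler_wpM2l.
have := D_DF bsg.1 (bounded_continuous_bounded bsg).
set u := (X in Cseries_cvg_to X _ -> _).
set v := (X in _ -> Cseries_cvg_to X _).
have -> : u = v.
  apply/funext => k; rewrite /u /v -mulrA; congr (_ * _).
  rewrite -fmorphV -rmorphM/=; congr (_%:C)%C; rewrite -mulrA; congr (_ * _).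
  rewrite mulrC; apply: cycle_index_homogeneous => i.
  rewrite -RintegralZl//; last first.
    exact/bounded_measurable_integrable/bounded_measurableX.
  by apply: eq_Rintegral => x _; rewrite exprMn.
set l := (X in Cseries_cvg_to _ X -> _).
set l' := (X in _ -> Cseries_cvg_to _ X).
suff -> : l = l' by [].
rewrite /l /l' /Cintegral; congr (_ +i* _)%C; apply: eq_Rintegral => eta _;
  congr (complex.Re (expi _)) || congr (complex.Im (expi _));
  rewrite RintegralZl//; exact: bounded_measurable_integrable.
Qed.

(** The moments and the integrals alpha (f^k) are Lipschitz in f, on functions
bounded by C, for the L^1 distances of the mean measure and of alpha; both are
controlled by approximating in L^1 of the sum of these two measures. *)
Lemma moment_bounded_measurable (f : borel X -> R) n : bounded_measurable f ->
  \int[D]_eta ((\int[as_probability eta]_x f x) ^+ n) = ferguson_moment f n.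
Proof.
move=> bf; have [mf [C fC]] := bf.
pose rho := mean_measure X_sc X_lc X_T2 D.
have fin_mu : fin_num_fun (measure_add alpha rho).
  move=> A mA; rewrite measure_addE fin_numD.
  by rewrite !fin_num_measure.
pose m : {measure set (borel X) -> \bar R} := measure_add alpha rho.
pose mu := HB.pack_for (FiniteMeasure.type (borel X) R) (Measure.sort m)
  (@Measure_isFinite.Build _ _ _ (Measure.sort m) fin_mu).
have muE (h : borel X -> R) : bounded_measurable h -> (forall x, 0 <= h x) ->
    \int[mu]_x h x = \int[alpha]_x h x + \int[rho]_x h x.
  move=> bh h0; have [mh _] := bh; rewrite /Rintegral -fineD.
  - rewrite -ge0_integral_measure_add//.
      by move=> x _; rewrite lee_fin.
    exact/measurable_EFinP.
  - exact/integrable_fin_num/bounded_measurable_integrable.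
  - exact/integrable_fin_num/bounded_measurable_integrable.
have /choice[g gP] : forall k : nat, exists g : X -> R,
    [/\ continuous g, forall x, `|g x| <= C & L1dist mu g f <= k.+1%:R^-1].
  by move=> k; exact: bounded_continuous_dense.
have bcg k : bounded_continuous (g k).
  by case: (gP k) => cg gC _; split => //; exists C.
have bg k := bounded_continuous_measurable (bcg k).
have bgf k : bounded_measurable (fun x : borel X => `|g k x - f x|).
  exact: bounded_measurable_dist.
have gf k : \int[alpha]_x `|(g k : borel X -> R) x - f x| +
    \int[rho]_x `|(g k : borel X -> R) x - f x| <= k.+1%:R^-1.
  by rewrite -muE//; case: (gP k).
have C0 : 0 <= C by rewrite (le_trans _ (fC point)).
have K0 i : 0 <= C ^+ i.-1 *+ i by rewrite mulrn_wge0// exprn_ge0.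
have lim_alpha i : \int[alpha]_x ((g k : borel X -> R) x ^+ i) @[k --> \oo] -->
    \int[alpha]_x (f x ^+ i).
  apply: (@cvg_dist_harmonic _ _ _ (C ^+ i.-1 *+ i)) => k.
  rewrite (le_trans (dist_Rintegral_exprn _ _ (bg k) bf _ fC))//.
    by case: (gP k).
  rewrite ler_wpM2l// (le_trans _ (gf k))// lerDl.
  exact: Rintegral_ge0.
have lim_D :
    \int[D]_eta ((\int[as_probability eta]_x (g k : borel X -> R) x) ^+ n)
    @[k --> \oo] --> \int[D]_eta ((\int[as_probability eta]_x f x) ^+ n).
  apply: (@cvg_dist_harmonic _ _ _ (C ^+ n.-1 *+ n)) => k.
  have bgk := bounded_measurable_integral X_sc X_lc X_T2 (bg k).
  have bfk := bounded_measurable_integral X_sc X_lc X_T2 bf.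
  apply: (le_trans (@dist_Rintegral_exprn _ _ _ D _ _ C n bgk bfk _ _)).
  - by move=> eta; apply: norm_integral_le => //; case: (gP k).
  - by move=> eta; exact: norm_integral_le.
  rewrite ler_wpM2l// (le_trans _ (gf k))//.
  rewrite (mean_measureE X_sc X_lc X_T2 D (bgf k))//.
  apply: ler_wpDl; first exact: Rintegral_ge0.
  apply: le_Rintegral => //.
  - exact/bounded_measurable_integrable/bounded_measurable_dist.
  - exact/bounded_measurable_integrable/bounded_measurable_integral.
  move=> eta _.
  rewrite -RintegralB//; [|exact: bounded_measurable_integrable..].
  apply: le_normr_Rintegral => //.
  exact/bounded_measurable_integrable/bounded_measurableB.
have lim_F : ferguson_moment (g k : borel X -> R) n @[k --> \oo] -->
    ferguson_moment f n.
  by apply: cvgM; [exact: cvg_cst|exact: cvg_cycle_index].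
have momE : (fun k => \int[D]_eta
      ((\int[as_probability eta]_x (g k : borel X -> R) x) ^+ n)) =
    (fun k => ferguson_moment (g k : borel X -> R) n).
  by apply/funext => k; exact: moment_continuous.
rewrite momE in lim_D.
exact: (cvg_unique (@norm_hausdorff _ _) lim_D lim_F).
Qed.

End moments.

(** * Joint moments *)

(** Used both for alpha, with functions on X, and for D, with the functionals
eta |-> eta f_j. *)
Lemma Rintegral_power_of_sum (R : realType) d (T : measurableType d)
    (mu : {finite_measure set T -> \bar R}) (q N : nat) (c : 'I_q -> R)
    (f : 'I_q -> T -> R) k : (k <= N)%N ->
  (forall j, bounded_measurable (f j)) ->
  \int[mu]_x ((\sum_j c j * f j x) ^+ k) =
  \sum_(b : box q N | mdeg (bval b) == k)
    multinomial R (bval b) * \prod_j c j ^+ b j *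
    \int[mu]_x (\prod_j f j x ^+ b j).
Proof.
move=> kN bf.
have bp (b : box q N) : bounded_measurable (fun x => \prod_j f j x ^+ b j).
  by apply: bounded_measurable_prod => j; exact: bounded_measurableX.
transitivity (\int[mu]_x (\sum_(b : box q N | mdeg (bval b) == k)
    multinomial R (bval b) * \prod_j c j ^+ b j * \prod_j f j x ^+ b j)).
  apply: eq_Rintegral => x _; rewrite (multinomial_theorem _ kN).
  apply: eq_bigr => b _; rewrite -mulrA -big_split/=; congr (_ * _).
  by apply: eq_bigr => j _; rewrite exprMn.
rewrite Rintegral_sum; last first.
  move=> b; apply: bounded_measurableM => //; exact: bounded_measurable_cst.
apply: eq_bigr => b _; rewrite RintegralZl//.
exact: bounded_measurable_integrable.
Qed.

Lemma multinomial_neq0 (R : realType) q (a : {ffun 'I_q -> nat}) :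
  multinomial R a != 0.
Proof.
rewrite /multinomial mulf_neq0 ?invr_eq0 ?pnatr_eq0 -?lt0n ?fact_gt0//.
by rewrite prodn_gt0// => j; rewrite fact_gt0.
Qed.

Theorem corollary6p4 (R : realType) (X : ptopologicalType)
    (X_sc : @second_countable X) (X_lc : locally_compact [set: X])
    (X_T2 : hausdorff_space X)
    (alpha : {finite_measure set (borel X) -> \bar R})
    (alpha_gt0 : (0 < alpha [set: borel X])%E)
    (D : probability (borel (narrow X R)) R)
    (D_DF : is_Dirichlet_Ferguson alpha D)
    (q : nat) (q_gt0 : (0 < q)%N) (n : {ffun 'I_q -> nat})
    (f : 'I_q -> borel X -> R)
    (f_mf : forall j, measurable_fun [set: borel X] (f j))
    (f_bd : forall j, bounded_fun (f j)) :
  \int[D]_eta (\prod_(j < q) (\int[(eta : probability (borel X) R)]_x f j x) ^+ n j)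
  = (mdeg n)`!%:R / rising (mass alpha) (mdeg n)
    * chromatic_cycle_index n
        (fun a => \int[alpha]_x (\prod_(j < q) f j x ^+ a j)).
Proof.
have bf j : bounded_measurable (f j).
  split=> //; have [M [_ fM]] := f_bd j.
  by exists (M + 1) => x; apply: fM => //; rewrite ltrDl.
pose N := mdeg n.
pose t (a : {ffun 'I_q -> nat}) := \int[alpha]_x (\prod_(j < q) f j x ^+ a j).
pose I (b : box q N) := \int[D]_eta
  (\prod_j (\int[as_probability eta]_x f j x) ^+ b j).
pose K := N`!%:R / rising (mass alpha) N.
have bY j := bounded_measurable_integral X_sc X_lc X_T2 (bf j).
(* Entries of total degree other than N are set to 0, as the polynomials are
     homogeneous of degree N. *)
pose u (b : box q N) :=
  if mdeg (bval b) == N then multinomial R (bval b) * I b else 0.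
pose v (b : box q N) := if mdeg (bval b) == N then
  multinomial R (bval b) * (K * chromatic_cycle_index (bval b) t) else 0.
have uv : u =1 v.
  apply: monomials_free => c.
  have bcf : bounded_measurable (fun x => \sum_j c j * f j x).
    apply: bounded_measurable_sum => j; apply: bounded_measurableM => //.
    exact: bounded_measurable_cst.
  have := moment_bounded_measurable X_sc X_lc X_T2 D_DF N bcf.
  have -> :
      \int[D]_eta ((\int[as_probability eta]_x (\sum_j c j * f j x)) ^+ N) =
      \sum_(b : box q N) (\prod_j c j ^+ b j) * u b.
    transitivity (\int[D]_eta
        ((\sum_j c j * \int[as_probability eta]_x f j x) ^+ N)).
      apply: eq_Rintegral => eta _; congr (_ ^+ _).
      rewrite Rintegral_sum; last first.
        move=> j; apply: bounded_measurableM => //.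
        exact: bounded_measurable_cst.
      apply: eq_bigr => j _; rewrite RintegralZl//.
      exact: bounded_measurable_integrable.
    rewrite (Rintegral_power_of_sum D c (leqnn N) bY) big_mkcond/=.
    apply: eq_bigr => b _; rewrite /u; case: ifPn => _; last by rewrite mulr0.
    by rewrite mulrA [_ * multinomial _ _]mulrC.
  move=> ->; rewrite /ferguson_moment.
  rewrite (@cycle_index_chromatic R q N c t); last first.
    move=> k kN; rewrite (Rintegral_power_of_sum alpha c kN bf).
    apply: eq_bigr => b _; congr (_ * _); apply: eq_Rintegral => x _.
    by apply: eq_bigr => j _; rewrite ffunE.
  rewrite mulr_sumr big_mkcond/=; apply: eq_bigr => b _; rewrite /v.
  by case: ifPn => _; rewrite ?mulr0// /K; ring.
have nN j : (n j < N.+1)%N by rewrite ltnS /N /mdeg (bigD1 j)//= leq_addr.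
pose m : box q N := [ffun j => Ordinal (nN j)].
have mE : bval m = n by apply/ffunP => j; rewrite !ffunE.
have := uv m; rewrite /u /v mE eqxx => /(mulfI (multinomial_neq0 R n)) <-.
apply: eq_Rintegral => eta _; apply: eq_bigr => j _.
by rewrite ffunE.
Qed.
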